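(* Let $\mathcal{H}$ be a separable complex Hilbert space, let $A, B \in L(\mathcal{H})$ have closed range, let $C \in L(\mathcal{H})$ and let $W \in L(\mathcal{H})^{+}$ be such that $W^{1/2} \in S_p$ for some $p$ with $1 < p < \infty$. Consider $F_p(X)=\Vert AXB-C\Vert_{p,W}^p$ for $X\in L(\mathcal{H})$. Then $X_0\in L(\mathcal{H})$ is a global minimum of $F_p$ if and only if $X_0$ is a solution $X$ of $$B\,\vert W^{1/2}(AXB-C) \vert^{p-1}\, U^{*} W^{1/2}A=0,$$ where $W^{1/2}(AXB-C)=U\vert W^{1/2}(AXB-C)\vert$ is the polar decomposition of the operator $W^{1/2}(AXB-C)$, with $U$ the partial isometry (depending on $X$) such that $N(U)=N(W^{1/2}(AXB-C))$.
   Context: $L(\mathcal{H})$ is the algebra of bounded linear operators on $\mathcal{H}$ and $L(\mathcal{H})^{+}$ is the cone of positive semidefinite operators. $N(T)$ denotes the nullspace of $T$, and $|T|=(T^*T)^{1/2}$. For $1\le p<\infty$, $S_p$ is the $p$-Schatten class of compact operators $T$ on $\mathcal{H}$ with $\sum_k\lambda_k(T)^p<\infty$, where $\lambda_k(T)$ are the eigenvalues of $|T|$ repeated according to multiplicity, and $\Vert T\Vert_p=(\sum_k\lambda_k(T)^p)^{1/p}$. When $W^{1/2}\in S_p$, $\Vert X\Vert_{p,W}=\Vert W^{1/2}X\Vert_p$ for $X\in L(\mathcal{H})$. *)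

(* Defs.v *)
From mathcomp Require Export all_boot all_order all_algebra.
From mathcomp Require Export all_classical all_reals all_analysis.
From mathcomp Require Export complex.

Set Implicit Arguments.
Unset Strict Implicit.
Unset Printing Implicit Defensive.

Import Order.TTheory GRing.Theory Num.Theory.
Import numFieldNormedType.Exports.

Local Open Scope classical_set_scope.
Local Open Scope ring_scope.
Local Open Scope complex_scope.

Section operators.
Variables (R : realType) (H : completeNormedModType R[i]).

(* H is a Hilbert space for dot: the norm of H, which is complete, is the one
   induced by dot.  The forms of {dot H for _} are linear in their first
   argument and conjugate-linear in the second. *)
Definition hilbert_dot (dot : {dot H for Num.conj}) : Prop :=
  forall x : H, dot x x = `|x| ^+ 2.

Definition separable_space : Prop :=
  exists D : set H, countable D /\ dense D.

Definition bounded_op : set (H -> H) :=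
  [set T | linear T /\ continuous T].

Definition compact_op : set (H -> H) :=
  [set T | bounded_op T /\ precompact (T @` [set x : H | `|x| <= 1])].

Definition nullspace (T : H -> H) : set H := T @^-1` [set 0].

Definition lin_indep (n : nat) (v : 'I_n -> H) : Prop :=
  forall c : 'I_n -> R[i], \sum_(i < n) c i *: v i = 0 -> forall i, c i = 0.

(* The dimension of a subspace E, +oo when it is not finite. *)
Definition dimension (E : set H) : \bar R :=
  ereal_sup [set n%:R%:E | n in [set n : nat |
    exists v : 'I_n -> H, (forall i, E (v i)) /\ lin_indep v]].

(* The multiplicity is 0 when l is not an eigenvalue of T. *)
Definition multiplicity (T : H -> H) (l : R) : \bar R :=
  dimension [set x : H | T x = l%:C *: x].

(* The operators defined below with xget exist and are unique in every case
   where they are used; the default value 0 is then irrelevant. *)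

(* The power P^s (s > 0) of a compact positive operator P. By the spectral
   theorem the eigenvectors of P span a dense subspace, so that P^s is the only
   bounded operator that acts as l^s on the eigenspace of every eigenvalue l. *)
Definition pow_op (P : H -> H) (s : R) : H -> H :=
  xget (fun=> 0) [set Q | bounded_op Q /\
    forall (l : R) (x : H), P x = l%:C *: x -> Q x = (l `^ s)%:C *: x].

Variable dot : {dot H for Num.conj}.

Definition adjoint (T : H -> H) : H -> H :=
  xget (fun=> 0) [set S | bounded_op S /\
    forall x y, dot (T x) y = dot x (S y)].

(* In R[i], 0 <= z means that z is real and nonnegative. *)
Definition positive_op : set (H -> H) :=
  [set T | bounded_op T /\ forall x, 0 <= dot (T x) x].

Definition sqrt_op (T : H -> H) : H -> H :=
  xget (fun=> 0) [set S | positive_op S /\ S \o S = T].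

Definition abs_op (T : H -> H) : H -> H := sqrt_op (adjoint T \o T).

Definition partial_isometry : set (H -> H) :=
  [set U | bounded_op U /\
    forall x, (forall y, nullspace U y -> dot x y = 0) -> `|U x| = `|x|].

(* The factor U of the polar decomposition T = U |T|. *)
Definition polar_op (T : H -> H) : H -> H :=
  xget (fun=> 0) [set U | [/\ partial_isometry U,
    nullspace U = nullspace T & T = U \o abs_op T]].

(* The sum of the p-th powers of the eigenvalues of |T|, repeated according to
   multiplicity; the eigenvalue 0 contributes nothing. *)
Definition schatten_sum (p : R) (T : H -> H) : \bar R :=
  \esum_(l in [set l : R | 0 < l])
    (multiplicity (abs_op T) l * (l `^ p)%R%:E)%E.

Definition schatten_class (p : R) : set (H -> H) :=
  [set T | compact_op T /\ (schatten_sum p T < +oo)%E].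

(* Finite exactly when the sum above is, in particular on schatten_class p. *)
Definition schatten_norm (p : R) (T : H -> H) : \bar R :=
  (schatten_sum p T `^ p^-1)%E.

Definition weighted_norm (p : R) (W X : H -> H) : \bar R :=
  schatten_norm p (sqrt_op W \o X).

Definition global_min (F : (H -> H) -> \bar R) (X0 : H -> H) : Prop :=
  forall X, bounded_op X -> (F X0 <= F X)%E.

End operators.

(* Main.v *)
Require Import Defs.
From mathcomp Require Import ring lra.
Set Implicit Arguments.
Unset Strict Implicit.
Unset Printing Implicit Defensive.
Import Order.TTheory GRing.Theory Num.Theory.
Import numFieldNormedType.Exports.
Local Open Scope classical_set_scope.
Local Open Scope ring_scope.
Local Open Scope complex_scope.

(* Write V = W^(1/2), T = V (A X0 B - C) and, by the singular value expansion
   T = sum_k s_k <., e_k> f_k, let S = |T|^(p-1) U^* = sum_k s_k^(p-1) <., f_k> e_k.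
   For orthonormal systems, sum_k |<K e_k, f_k>|^p <= ||K||_p^p; with the tangent
   line of x^p this gives the subgradient inequality
     ||T + D||_p^p >= ||T||_p^p + p Re sum_k s_k^(p-1) <D e_k, f_k>.
   For D = V A Y B the last sum is the trace of S V A Y B; it vanishes when
   B S V A = 0, since Y may be replaced by operators of finite rank up to an error
   controlled by Hoelder's inequality.  Conversely, if X0 is a minimum, the
   inequality taken at a perturbed operator T + tD, with D of rank one, shows that
   the derivative along D has the right sign at T + tD, hence at T because
   |T|^(p-1) U^* depends continuously on T.  Rank one perturbations suffice to
   force B S V A = 0. *)

(** * Powers of nonnegative reals *)

(** The subgradient inequality bounds ||T + D||_p^p from below, and so does minimality; applied at T
    it says nothing about the sign of the derivative at a minimum. Read from T + tD back to T, it
    bounds ||T + tD||_p^p from above, and minimality then forces the sign. The price is a limit t ->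
    0 along which singular vectors may jump at multiple singular values. Continuity is therefore
    proved for the operator U |T|^(p-1) as a whole, in the strong sense, and tested on the
    eigenvectors of T^* T for the limit T only; these span a dense subspace.

    In the other direction, B S V A = 0 concerns the product in an order different from the one
    inside the trace. Moving factors around the trace is free for operators of finite rank, and the
    approximation serves to reduce to them.

    The modulus, its power, the polar factor and the adjoint are choices from a specification. Each
    is evaluated by exhibiting a diagonal operator that meets the specification and proving
    uniqueness, with the singular value expansion as the only spectral tool. *)

Section PowR.
Variable R : realType.
Implicit Types (a x s d p : R).

(** For p > 1 this is Young's inequality for x and a^(p-1), whose conjugate power is a^p. *)
Lemma powR_tangent p a x : 1 <= p -> 0 <= a -> 0 <= x ->
  a `^ p + p * a `^ (p - 1) * (x - a) <= x `^ p.
Proof.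
move=> p1 a0 x0; have p0 : 0 < p by lra.
have [->|pn1] := eqVneq p 1; first by rewrite subrr powRr0 !powRr1//; lra.
have p1' : 0 < p - 1 by move: p1; rewrite le_eqVlt eq_sym (negbTE pn1) subr_gt0.
have q0 : 0 < p / (p - 1) by rewrite divr_gt0.
have e1 : p^-1 + (p / (p - 1))^-1 = 1 by field; apply/andP; split; lra.
have := conjugate_powR x0 (powR_ge0 a (p - 1)) p0 q0 e1.
rewrite -powRrM (_ : (p - 1) * _ = p); last by field; lra.
rewrite -(ler_pM2l p0) (_ : p * (_ + _) = x `^ p + (p - 1) * a `^ p); last first.
  by field; apply/andP; split; lra.
have := mulr_powRB1 a0 p0; set u := a `^ p; set v := a `^ (p - 1).
move=> uv; nra.
Qed.

(** The tangent of x^p at [e * s], evaluated at [d]. The free weight [e] lets the first term be made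
    small before the second. *)
Lemma powR_young p s d e : 1 < p -> 0 <= s -> 0 <= d -> 0 < e ->
  s `^ (p - 1) * d <= e * s `^ p + (e `^ (p - 1))^-1 * d `^ p.
Proof.
move=> p1 s0 d0 e0; have es0 : 0 <= e * s by rewrite mulr_ge0 ?(ltW e0).
have e1 : 0 < e `^ (p - 1) by exact: powR_gt0.
have := powR_tangent (ltW p1) es0 d0.
rewrite !powRM ?(ltW e0)//.
have := @mulr_powRB1 _ e p (ltW e0) ltac:(lra); have := @mulr_powRB1 _ s p s0 ltac:(lra).
have := powR_ge0 s p; have := powR_ge0 s (p-1); have := powR_ge0 d p; have := powR_ge0 e p.
set u := s `^ (p-1); set v := s `^ p; set w := e `^ p; set z := e `^ (p - 1) in e1 *.
set D := d `^ p => w0 D0 u0 v0 uv zw.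
move=> H; rewrite -(ler_pM2l e1) (_ : z * (e * v + _) = w * v + D); last first.
  by rewrite -zw; field; rewrite gt_eqF.
have wv : p * (z * u) * (e * s) = p * (w * v) by rewrite -uv -zw; ring.
have : 0 <= w * v by rewrite mulr_ge0.
have : 0 <= z * (u * d) by rewrite !mulr_ge0// ltW.
move: H; rewrite mulrBr wv => H; nra.
Qed.

Lemma powR_cont p s e : 0 < p -> 0 <= s -> 0 < e ->
  exists2 d, 0 < d & forall x, 0 <= x -> `|x - s| < d -> `|x `^ p - s `^ p| < e.
Proof.
move=> p0 s0 e0; have [->|sn0] := eqVneq s 0.
  exists (e `^ p^-1); first exact: powR_gt0.
  move=> x x0; rewrite powR0 ?gt_eqF// !subr0 !ger0_norm ?powR_ge0// => xe.
  have := gt0_ltr_powR p0 _ _ xe; rewrite -powRrM mulVf ?gt_eqF// powRr1 ?ltW//.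
  by apply; rewrite nnegrE// powR_ge0.
have s1 : s \in `]0, +oo[ by rewrite in_itv /= andbT lt_def sn0.
have /derivable1_diffP/differentiable_continuous := @derivable_powR R 1 p s s1.
move=> /cvgrPdist_lt /(_ _ e0) /nbhs_ballP[d /= d0 H].
exists d => // x x0 xd; rewrite distrC; apply: H.
by rewrite /ball /= distrC.
Qed.

(* At a singular value s, this compares x^(p-1) with a linear function of x up to
   the defect of x^2 from s^2, which is visible on T^* T: no functional calculus
   is needed to prove that |T|^(p-1) depends continuously on T. *)
Lemma powR_modulus p s M e : 1 < p -> 0 <= s -> 0 < e ->
  exists c C, [/\ s `^ (p - 1) = c * s, 0 <= C & forall x, 0 <= x <= M ->
    (x `^ (p - 1) - c * x) ^+ 2 <= e + C * (x ^+ 2 - s ^+ 2) ^+ 2].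
Proof.
move=> p1 s0 e0.
have [c cs] : exists c, s `^ (p - 1) = c * s.
  have [->|sn0] := eqVneq s 0; last by exists (s `^ (p - 1) / s); rewrite divfK.
  by exists 0; rewrite mulr0 powR0//; lra.
(* Since r <= 1 and r <= e, a quantity of size at most r has square at most e. *)
pose r := Num.min 1 e; have r0 : 0 < r by rewrite /r lt_min e0 ltr01.
have [d d0 Hd] := @powR_cont (p - 1) s (r / 2) ltac:(lra) s0 ltac:(lra).
pose d' := Num.min d (r / 2 / (1 + `|c|)).
have c1 : 0 < 1 + `|c| by rewrite ltr_pwDl.
have d'0 : 0 < d' by rewrite /d' lt_min d0 !divr_gt0.
pose K := (M `^ (p - 1) + `|c| * M) ^+ 2.
have K0 : 0 <= K by exact: sqr_ge0.
exists c, (K / (d' ^+ 2) ^+ 2); split=> //.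
  by rewrite divr_ge0 ?sqr_ge0.
move=> x /andP[x0 xM].
have [xd|xd] := ltP `|x - s| d'.
  have h1 : `|x `^ (p - 1) - c * x| <= r.
    rewrite (_ : _ - _ = (x `^ (p-1) - s `^ (p-1)) - c * (x - s)); last first.
      by rewrite cs; ring.
    rewrite (le_trans (ler_normB _ _))// normrM [leRHS](splitr r) lerD//.
      by rewrite ltW// Hd// (lt_le_trans xd)// /d' ge_min lexx.
    apply: le_trans (_ : `|c| * (r / 2 / (1 + `|c|)) <= _).
      by rewrite ler_wpM2l// ltW// (lt_le_trans xd)// /d' ge_min lexx orbT.
    rewrite mulrCA ler_piMr ?divr_ge0 ?ltW//.
    by rewrite ltr_pdivrMr// mul1r ltrDr.
  apply: ler_wpDr; first by apply: mulr_ge0; [apply: divr_ge0 => //|]; exact: sqr_ge0.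
  rewrite -real_normK ?num_real// expr2 -[leRHS]mul1r ler_pM//.
    by rewrite (le_trans h1)// /r ge_min lexx.
  by rewrite (le_trans h1)// /r ge_min lexx orbT.
(* Away from s, |x^2 - s^2| = |x - s| (x + s) >= |x - s|^2 >= d'^2, so the second term alone is at
   least K, which bounds the left-hand side on [0, M]. *)
apply: ler_wpDl; first exact: ltW.
have K1 : (x `^ (p - 1) - c * x) ^+ 2 <= K.
  rewrite /K -[leLHS]real_normK ?num_real// lerXn2r ?nnegrE//.
    by rewrite addr_ge0 ?powR_ge0// mulr_ge0// (le_trans x0).
  rewrite (le_trans (ler_normB _ _))// normrM (ger0_norm (powR_ge0 _ _)) (ger0_norm x0).
  rewrite lerD ?ler_wpM2l// ge0_ler_powR ?nnegrE//; first by lra.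
  exact: le_trans xM.
apply: (le_trans K1); rewrite mulrAC -mulrA ler_peMr//.
rewrite ler_pdivlMr ?exprn_gt0// mul1r.
rewrite -[leRHS]real_normK ?num_real// lerXn2r ?nnegrE ?sqr_ge0//.
apply: le_trans (_ : `|x - s| ^+ 2 <= _).
  by rewrite lerXn2r ?nnegrE// ltW.
rewrite subr_sqr normrM expr2 ler_wpM2l//.
by rewrite (ger0_norm (addr_ge0 x0 s0)) ler_norml; apply/andP; split; lra.
Qed.
End PowR.

(** * Real-valued norms *)

Section RealNorm.
Variable R : realType.
Local Notation C := R[i].

(* The library norm of H takes its values in R[i]. *)
Definition nm (V : normedZmodType C) (x : V) : R := complex.Re `|x|.

Section Generic.
Variable V : normedZmodType C.
Implicit Types x y : V.

Lemma nmE x : `|x| = (nm x)%:C.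
Proof. by rewrite /nm RRe_real// ger0_real. Qed.

Lemma nm_ge0 x : 0 <= nm x. Proof. by rewrite -ler0c -nmE. Qed.

Lemma nm0 : nm (0 : V) = 0. Proof. by rewrite /nm normr0. Qed.

Lemma nm_eq0 x : (nm x == 0) = (x == 0).
Proof. by rewrite -(normr_eq0 x) nmE -(inj_eq (@complexI R)). Qed.

Lemma nmN x : nm (- x) = nm x. Proof. by rewrite /nm normrN. Qed.

Lemma nmB x y : nm (x - y) = nm (y - x). Proof. by rewrite -nmN opprB. Qed.

Lemma nmD x y : nm (x + y) <= nm x + nm y.
Proof. by rewrite -lecR rmorphD /= -!nmE ler_normD. Qed.

Lemma nm_tri z x y : nm (x - y) <= nm (x - z) + nm (z - y).
Proof. by rewrite (le_trans _ (nmD _ _))// addrA subrK. Qed.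

Lemma nm_dist x y : `|nm x - nm y| <= nm (x - y).
Proof.
by rewrite -lecR -nmE (le_trans _ (ler_dist_dist x y))// !nmE -rmorphB normc_def /=
  expr0n addr0 sqrtr_sqr.
Qed.

Lemma nm_sum (I : Type) (r : seq I) (P : pred I) (F : I -> V) :
  nm (\sum_(i <- r | P i) F i) <= \sum_(i <- r | P i) nm (F i).
Proof.
elim/big_ind2: _ => [|x a y b xa yb|//]; first by rewrite nm0.
by rewrite (le_trans (nmD _ _))// lerD.
Qed.

(** Stated through a real sequence so that real squeeze and order arguments apply, to vectors and
    complex scalars alike. *)
Definition tends (u : nat -> V) (x : V) := (fun n => nm (u n - x)) @ \oo --> (0 : R).

Lemma tendsP u x : tends u x <->
  forall e, 0 < e -> exists N, forall n, (N <= n)%N -> nm (u n - x) < e.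
Proof.
split=> [/cvgr0Pnorm_lt ux e /ux [N _ H]|H].
  by exists N => n /H; rewrite ger0_norm ?nm_ge0.
apply/cvgr0Pnorm_lt => e /H[N HN]; exists N => // n /= /HN.
by rewrite ger0_norm ?nm_ge0.
Qed.

Lemma tends_squeeze (u : nat -> V) x (a : nat -> R) :
  (forall n, nm (u n - x) <= a n) -> a @ \oo --> (0 : R) -> tends u x.
Proof.
move=> ua a0; apply: (squeeze_cvgr _ (cvg_cst 0) a0).
by near=> n; rewrite nm_ge0 ua.
Unshelve. all: by end_near. Qed.

Lemma tends_cst x : tends (fun=> x) x.
Proof. by rewrite /tends subrr nm0; exact: cvg_cst. Qed.

Lemma tends_eq u v x : (forall n, u n = v n) -> tends u x -> tends v x.
Proof. by move=> /funext ->. Qed.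

Lemma tendsD u v x y : tends u x -> tends v y -> tends (fun n => u n + v n) (x + y).
Proof.
move=> ux vy; apply: tends_squeeze (_ : (fun n => nm (u n - x) + nm (v n - y)) @ \oo --> _).
  by move=> n; rewrite opprD addrACA nmD.
by rewrite -[in X in _ --> X](addr0 0); exact: cvgD.
Qed.

Lemma tendsN u x : tends u x -> tends (fun n => - u n) (- x).
Proof. by apply: tends_squeeze => n; rewrite -opprD nmN. Qed.

Lemma tendsB u v x y : tends u x -> tends v y -> tends (fun n => u n - v n) (x - y).
Proof. by move=> ux vy; apply: tendsD => //; exact: tendsN. Qed.

Lemma tends_sum (I : Type) (r : seq I) (P : pred I) (u : I -> nat -> V) (x : I -> V) :
  (forall i, P i -> tends (u i) (x i)) ->
  tends (fun n => \sum_(i <- r | P i) u i n) (\sum_(i <- r | P i) x i).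
Proof.
move=> ux; elim: r => [|i r IH].
  by apply: tends_eq (tends_cst _) => n; rewrite !big_nil.
rewrite big_cons; case: ifPn => Pi.
  by apply: tends_eq (tendsD (ux _ Pi) IH) => n; rewrite big_cons Pi.
by apply: tends_eq IH => n; rewrite big_cons (negbTE Pi).
Qed.

Lemma tends_nm u x : tends u x -> (fun n => nm (u n)) @ \oo --> nm x.
Proof.
move=> ux; apply/cvgrPdist_lt => e /(proj1 (tendsP _ _) ux)[N HN].
by exists N => // n /= /HN; rewrite nmB; exact: le_lt_trans (nm_dist _ _).
Qed.

Lemma tends_unique u x y : tends u x -> tends u y -> x = y.
Proof.
move=> ux uy; apply/eqP; rewrite -subr_eq0 -nm_eq0 eq_le nm_ge0 andbT.
apply/ler_addgt0Pr => e e0; rewrite add0r.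
have e2 : 0 < e / 2 by rewrite divr_gt0.
have [N HN] := proj1 (tendsP _ _) ux _ e2; have [M HM] := proj1 (tendsP _ _) uy _ e2.
have := HN _ (leq_maxl N M); have := HM _ (leq_maxr N M).
have := nm_tri (u (maxn N M)) x y; rewrite (nmB x (u _)); lra.
Qed.

Lemma tends_bound u x (b : R) : (forall n, nm (u n) <= b) -> tends u x -> nm x <= b.
Proof. by move=> ub /tends_nm ux; apply: (cvgr_to_le ux); apply: nearW. Qed.

End Generic.

Section Scalars.
Implicit Types a b : C.

Lemma nmM a b : nm (a * b) = nm a * nm b.
Proof. by apply: (@complexI R); rewrite rmorphM /= -!nmE normrM. Qed.

Lemma nmR (r : R) : nm (r%:C : C) = `|r|.
Proof. by rewrite /nm normc_def /= expr0n addr0 sqrtr_sqr. Qed.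

Lemma nmJ a : nm a^* = nm a.
Proof. by rewrite /nm normcJ. Qed.

Lemma mulJ a : a * a^* = (nm a ^+ 2)%:C.
Proof. by rewrite -sqr_normc nmE rmorphXn. Qed.

Lemma nm_Re a : `|complex.Re a| <= nm a.
Proof. by rewrite -lecR -nmE normc_ge_Re. Qed.

Lemma Re_le_nm a : complex.Re a <= nm a.
Proof. exact: le_trans (ler_norm _) (nm_Re _). Qed.

Lemma cReD a b : complex.Re (a + b) = complex.Re a + complex.Re b.
Proof. by case: a b => [? ?] [? ?]. Qed.

Lemma cReN a : complex.Re (- a) = - complex.Re a.
Proof. by case: a. Qed.

Lemma cReB a b : complex.Re (a - b) = complex.Re a - complex.Re b.
Proof. by rewrite cReD cReN. Qed.

Lemma cReMl (r : R) a : complex.Re (r%:C * a) = r * complex.Re a.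
Proof. by case: a => x y /=; rewrite mul0r subr0. Qed.

Lemma cRe_sum (I : Type) (s : seq I) (P : pred I) (F : I -> C) :
  complex.Re (\sum_(i <- s | P i) F i) = \sum_(i <- s | P i) complex.Re (F i).
Proof. by elim/big_rec2: _ => // i x y _ <-; rewrite cReD. Qed.

Lemma tends_Re (u : nat -> C) a : tends u a ->
  (fun n => complex.Re (u n)) @ \oo --> complex.Re a.
Proof.
move=> ux; apply/cvgrPdist_lt => e /(proj1 (tendsP _ _) ux)[N HN].
exists N => // n /= /HN; apply: le_lt_trans.
by rewrite distrC -cReB nm_Re.
Qed.

End Scalars.

Lemma nmZ (V : normedModType C) (a : C) (x : V) : nm (a *: x) = nm a * nm x.
Proof. by apply: (@complexI R); rewrite rmorphM /= -!nmE normrZ. Qed.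

Lemma tendsMl (c : C) (u : nat -> C) (x : C) :
  tends u x -> tends (fun n => c * u n) (c * x).
Proof.
move=> ux; apply: tends_squeeze (_ : (fun n => nm c * nm (u n - x)) @ \oo --> _).
  by move=> n; rewrite -mulrBr nmM.
by rewrite -[in X in _ --> X](mulr0 (nm c)); exact: cvgMr.
Qed.

Lemma tendsZ (V : normedModType C) (c : C) (u : nat -> V) (x : V) :
  tends u x -> tends (fun n => c *: u n) (c *: x).
Proof.
move=> ux; apply: tends_squeeze (_ : (fun n => nm c * nm (u n - x)) @ \oo --> _).
  by move=> n; rewrite -scalerBr nmZ.
by rewrite -[in X in _ --> X](mulr0 (nm c)); exact: cvgMr.
Qed.

End RealNorm.

(** * Hilbert spaces and orthonormal families *)

Section Hilbert.
Variables (R : realType) (H : completeNormedModType R[i]).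
Variable dot : {dot H for Num.conj}.
Hypothesis hdot : hilbert_dot dot.
Local Notation C := R[i].
Implicit Types x y z : H.

Lemma dotC x y : dot x y = (dot y x)^*.
Proof. by rewrite hermC expr0 mul1r. Qed.

Lemma dotDl x y z : dot (x + y) z = dot x z + dot y z.
Proof. exact: linearDl. Qed.

Lemma dotDr x y z : dot x (y + z) = dot x y + dot x z.
Proof. exact: linearDr. Qed.

Lemma dotNl x y : dot (- x) y = - dot x y. Proof. exact: linearNl. Qed.
Lemma dotNr x y : dot x (- y) = - dot x y. Proof. exact: linearNr. Qed.

Lemma dotBl x y z : dot (x - y) z = dot x z - dot y z.
Proof. by rewrite dotDl dotNl. Qed.

Lemma dotBr x y z : dot x (y - z) = dot x y - dot x z.
Proof. by rewrite dotDr dotNr. Qed.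

Lemma dotZl (a : C) x y : dot (a *: x) y = a * dot x y.
Proof. exact: linearZl_LR. Qed.

Lemma dotZr (a : C) x y : dot x (a *: y) = a^* * dot x y.
Proof. exact: linearZr_LR. Qed.

Lemma dotZrR (r : R) x y : dot x (r%:C *: y) = r%:C * dot x y.
Proof. by rewrite dotZr; congr (_ * _); exact: conjc_real. Qed.

Lemma dot0l x : dot 0 x = 0. Proof. exact: linear0l. Qed.
Lemma dot0r x : dot x 0 = 0. Proof. exact: linear0r. Qed.

Lemma dot_suml (I : Type) (r : seq I) (P : pred I) (F : I -> H) y :
  dot (\sum_(i <- r | P i) F i) y = \sum_(i <- r | P i) dot (F i) y.
Proof. by elim/big_rec2: _ => [|i a b _ <-]; rewrite ?dot0l ?dotDl. Qed.

Lemma dot_sumr (I : Type) (r : seq I) (P : pred I) (F : I -> H) y :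
  dot y (\sum_(i <- r | P i) F i) = \sum_(i <- r | P i) dot y (F i).
Proof. by elim/big_rec2: _ => [|i a b _ <-]; rewrite ?dot0r ?dotDr. Qed.

Lemma dotxx x : dot x x = (nm x ^+ 2)%:C.
Proof. by rewrite hdot nmE rmorphXn. Qed.

Lemma dotxx_eq0 x : dot x x = 0 -> x = 0.
Proof.
move=> /eqP; rewrite dotxx -(rmorph0 (real_complex R)) (inj_eq (@complexI R)).
by rewrite sqrf_eq0 nm_eq0 => /eqP.
Qed.

Lemma dot_eqP x y : (forall z, dot z x = dot z y) -> x = y.
Proof.
move=> E; apply/eqP; rewrite -subr_eq0; apply/eqP/dotxx_eq0.
by rewrite dotBr E subrr.
Qed.

Lemma nm_sqD x y : nm (x + y) ^+ 2 = nm x ^+ 2 + nm y ^+ 2 + 2 * complex.Re (dot x y).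
Proof.
apply: (@complexI R); rewrite -dotxx dotDl !dotDr !dotxx (dotC y x) !rmorphD (rmorphM _ 2) /=.
rewrite (_ : (2 : R)%:C = 2 :> C) -?addcJ; last exact: (rmorph_nat (real_complex R) 2).
by ring.
Qed.

Lemma CauchySchwarz x y : nm (dot x y) <= nm x * nm y.
Proof.
have [->|y0] := eqVneq y 0; first by rewrite dot0r !nm0 mulr0.
have ny : 0 < nm y by rewrite lt_def nm_eq0 y0 nm_ge0.
(* The vector x + r t y is the component of x orthogonal to y. *)
pose r := - (nm y ^+ 2)^-1; pose t := dot x y.
have := sqr_ge0 (nm (x + (r%:C * t) *: y)).
rewrite nm_sqD nmZ nmM dotZr -/t.
have -> : (r%:C * t)^* * t = r%:C * (nm t ^+ 2)%:C.
  by rewrite -mulJ (rmorphM (@conjc R)) [t * _]mulrC mulrA; congr (_ * _ * _); exact: conjc_real.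
rewrite cReMl /= nmR /r normrN ger0_norm ?invr_ge0 ?sqr_ge0// {r} => h.
have : nm (dot x y) ^+ 2 <= (nm x * nm y) ^+ 2.
  move: h; set a := nm (dot x y); set b := nm x; move: ny; set c := nm y => c0.
  rewrite (_ : _ + _ = (b ^+ 2 * c ^+ 2 - a ^+ 2) / c ^+ 2); last first.
    by field; rewrite gt_eqF.
  by rewrite pmulr_lge0 ?invr_gt0 ?exprn_gt0// subr_ge0 exprMn.
by rewrite ler_sqr ?nnegrE ?mulr_ge0 ?nm_ge0.
Qed.

Lemma tends_dotl (u : nat -> H) x y : tends u x -> tends (fun n => dot (u n) y) (dot x y).
Proof.
move=> ux; apply: tends_squeeze (_ : (fun n => nm (u n - x) * nm y) @ \oo --> _).
  by move=> n; rewrite -dotBl CauchySchwarz.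
by rewrite -[in X in _ --> X](mul0r (nm y)); exact: cvgMl.
Qed.

Lemma tends_dotr (u : nat -> H) x y : tends u x -> tends (fun n => dot y (u n)) (dot y x).
Proof.
move=> ux; apply: tends_squeeze (_ : (fun n => nm y * nm (u n - x)) @ \oo --> _).
  by move=> n; rewrite -dotBr CauchySchwarz.
by rewrite -[in X in _ --> X](mulr0 (nm y)); exact: cvgMr.
Qed.

Lemma cauchy_tends (u : nat -> H) :
  (forall e, 0 < e -> exists N, forall m n, (N <= m)%N -> (m <= n)%N -> nm (u n - u m) < e) ->
  exists x, tends u x.
Proof.
move=> Hu; have : cvg (u @ \oo).
  apply/cauchy_cvgP/cauchy_ballP => e e0.
  have eR : e = (complex.Re e)%:C by rewrite RRe_real// gtr0_real.
  have re0 : 0 < complex.Re e by rewrite -ltcR -eR.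
  have [N HN] := Hu _ re0.
  exists (u @` [set n | (N <= n)%N], u @` [set n | (N <= n)%N]) => /=.
    by split; exists N => // n /= Nn; exists n.
  move=> [_ _] /= [[m Nm <-] [n Nn <-]]; rewrite -ball_normE /= nmE eR ltcR.
  by have [mn|nm'] := leqP m n; [rewrite nmB HN|rewrite HN// ltnW].
move=> /cvg_ex[x ux]; exists x; apply/tendsP => e e0.
have : 0 < e%:C :> C by rewrite ltcR.
move=> e0'; have /cvgrPdist_lt/(_ _ e0')[N _ HN] := ux.
by exists N => n /HN /=; rewrite nmE ltcR nmB.
Qed.

End Hilbert.

(** * Bounded operators *)

Section Operators.
Variables (R : realType) (H : completeNormedModType R[i]).
Local Notation C := R[i].
Implicit Types (x y z : H) (T S : H -> H).

Section Linear.
Variable T : H -> H.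
Hypothesis lT : linear T.

Lemma linop0 : T 0 = 0.
Proof. by have := lT (-1) 0 0; rewrite !scaleN1r oppr0 addr0 addNr. Qed.

Lemma linopZ (a : C) x : T (a *: x) = a *: T x.
Proof. by have := lT a x 0; rewrite linop0 !addr0. Qed.

Lemma linopD x y : T (x + y) = T x + T y.
Proof. by have := lT 1 x y; rewrite !scale1r. Qed.

Lemma linopN x : T (- x) = - T x.
Proof. by rewrite -scaleN1r linopZ scaleN1r. Qed.

Lemma linopB x y : T (x - y) = T x - T y.
Proof. by rewrite linopD linopN. Qed.

Lemma linop_sum (I : Type) (r : seq I) (P : pred I) (F : I -> H) :
  T (\sum_(i <- r | P i) F i) = \sum_(i <- r | P i) T (F i).
Proof. by elim/big_rec2: _ => [|i a b _ <-]; rewrite ?linop0 ?linopD. Qed.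

End Linear.

Lemma bounded_opP T : bounded_op T <->
  linear T /\ exists2 c, 0 <= c & forall x, nm (T x) <= c * nm x.
Proof.
split=> [[lT cT]|[lT [c c0 Tc]]]; split=> //.
  have /cvgrPdist_lt/(_ _ (@ltr01 C)) /nbhs_ballP[d /= d0 Hd] := cT 0.
  have dR : d = (complex.Re d)%:C by rewrite RRe_real// gtr0_real.
  have d'0 : 0 < complex.Re d by rewrite -ltcR -dR.
  set e := complex.Re d in d'0 dR.
  (* A vector rescaled to norm e / 2 lies in the ball of radius e, on which T has norm below 1. *)
  exists (2 / e); first by rewrite divr_ge0// ltW.
  move=> x; have [->|x0] := eqVneq x 0; first by rewrite linop0// nm0 mulr0.
  have nx : 0 < nm x by rewrite lt_def nm_eq0 x0 nm_ge0.
  have k0 : 0 <= e / 2 / nm x by rewrite !divr_ge0// ltW.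
  have /Hd : ball (0 : H) d ((e / 2 / nm x)%:C *: x).
    rewrite -ball_normE /= sub0r nmE dR ltcR nmN nmZ nmR ger0_norm//.
    by rewrite divfK ?gt_eqF//; lra.
  rewrite linop0// sub0r /= nmE (ltcR _ 1) nmN linopZ// nmZ nmR ger0_norm// => h.
  have -> : nm (T x) = 2 / e * nm x * (e / 2 / nm x * nm (T x)).
    by field; rewrite !gt_eqF.
  by rewrite ler_piMr ?(ltW h)// !mulr_ge0 ?invr_ge0 ?nm_ge0 ?(ltW d'0).
move=> x; apply/cvgrPdist_lt => e e0.
have eR : e = (complex.Re e)%:C by rewrite RRe_real// gtr0_real.
have e'0 : 0 < complex.Re e by rewrite -ltcR -eR.
have c1 : 0 < c + 1 by lra.
apply/nbhs_ballP; exists (complex.Re e / (c + 1))%:C => /=.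
  by rewrite ltcR divr_gt0.
move=> y; rewrite -ball_normE /= nmE ltcR ltr_pdivlMr// => xy.
rewrite -linopB// nmE eR ltcR (le_lt_trans (Tc _))// (le_lt_trans _ xy)//.
by rewrite mulrC ler_wpM2l ?nm_ge0//; lra.
Qed.

Lemma bop_bound T : bounded_op T -> exists2 c, 0 <= c & forall x, nm (T x) <= c * nm x.
Proof. by move=> /bounded_opP[]. Qed.

Lemma bop_bound1 T : bounded_op T -> exists2 c, 0 < c & forall x, nm (T x) <= c * nm x.
Proof.
move=> /bop_bound[c c0 Hc]; exists (c + 1); first lra.
by move=> x; rewrite (le_trans (Hc x))// ler_wpM2r ?nm_ge0//; lra.
Qed.

Lemma tends_op T (u : nat -> H) x : bounded_op T -> tends u x ->
  tends (fun n => T (u n)) (T x).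
Proof.
move=> /bounded_opP[lT [c c0 Tc]] ux.
apply: tends_squeeze (_ : (fun n => c * nm (u n - x)) @ \oo --> _).
  by move=> n; rewrite -linopB.
by rewrite -[in X in _ --> X](mulr0 c); exact: cvgMr.
Qed.

Lemma bop_comp S T : bounded_op S -> bounded_op T -> bounded_op (S \o T).
Proof.
move=> [lS cS] [lT cT]; split=> [a x y|x]; first by rewrite /= lT lS.
by apply: continuous_comp; [exact: cT|exact: cS].
Qed.

Lemma bop_add S T : bounded_op S -> bounded_op T -> bounded_op (fun x => S x + T x).
Proof.
move=> /bounded_opP[lS [c c0 Sc]] /bounded_opP[lT [d d0 Td]]; apply/bounded_opP; split.
  by move=> a x y; rewrite lS lT scalerDr addrACA.
exists (c + d); first exact: addr_ge0.
by move=> x; rewrite mulrDl (le_trans (nmD _ _))// lerD.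
Qed.

Lemma bop_scale (a : C) T : bounded_op T -> bounded_op (fun x => a *: T x).
Proof.
move=> /bounded_opP[lT [d d0 Td]]; apply/bounded_opP; split.
  by move=> b x y; rewrite lT scalerDr !scalerA mulrC.
exists (nm a * d); first by rewrite mulr_ge0 ?nm_ge0.
by move=> x; rewrite nmZ -mulrA ler_wpM2l ?nm_ge0.
Qed.

Lemma bop_sub S T : bounded_op S -> bounded_op T -> bounded_op (fun x => S x - T x).
Proof.
move=> bS bT; rewrite (_ : (fun x => _) = (fun x => S x + (-1) *: T x)).
  by apply: bop_add => //; exact: bop_scale.
by apply/funext => x; rewrite scaleN1r.
Qed.

Lemma bop_id : bounded_op (@id H).
Proof. by apply/bounded_opP; split=> //; exists 1 => // x; rewrite mul1r. Qed.

Lemma bop_zero : bounded_op (fun=> 0 : H).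
Proof.
apply/bounded_opP; split; first by move=> a x y; rewrite scaler0 addr0.
by exists 0 => // x; rewrite nm0 mul0r.
Qed.

End Operators.

(** * Orthonormal sequences, Bessel and Riesz-Fischer *)

Section Orthonormal.
Variables (R : realType) (H : completeNormedModType R[i]).
Variable dot : {dot H for Num.conj}.
Hypothesis hdot : hilbert_dot dot.
Local Notation C := R[i].
Implicit Types (x y z : H) (T S : H -> H).

Lemma bop_rank1 x y : bounded_op (fun z => dot z x *: y).
Proof.
apply/bounded_opP; split; first by move=> a u v; rewrite dotDl dotZl scalerDl scalerA.
exists (nm x * nm y); first by rewrite mulr_ge0 ?nm_ge0.
move=> z; rewrite nmZ (mulrC (nm x)) -mulrA [leLHS]mulrC ler_wpM2l ?nm_ge0//.
by rewrite mulrC (CauchySchwarz hdot).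
Qed.

(* Zero vectors are allowed, so that finite orthonormal families are sequences too. *)
Definition ons (e : nat -> H) :=
  forall i j, dot (e i) (e j) = ((i == j) && (e i != 0))%:R.

Variable e : nat -> H.
Hypothesis one : ons e.

Lemma ons_nm1 i : nm (e i) = (e i != 0)%:R.
Proof.
have : (nm (e i) ^+ 2)%:C = ((e i != 0)%:R : R)%:C.
  by rewrite -(dotxx hdot) one eqxx /= (rmorph_nat (real_complex R)).
move=> /(@complexI R) h; apply/eqP; rewrite -(@eqrXn2 _ 2) ?nm_ge0// h.
by case: (e i != 0); rewrite ?expr1n ?expr0n.
Qed.

Lemma ons_le1 i : nm (e i) <= 1.
Proof. by rewrite ons_nm1; case: (e i != 0). Qed.

Lemma dot_ons_sum (c : nat -> C) m n j :
  dot (\sum_(m <= i < n) c i *: e i) (e j) = if (m <= j < n)%N then c j * (e j != 0)%:R else 0.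
Proof.
rewrite dot_suml; under eq_bigr do rewrite dotZl one.
case: ifPn => mjn.
  rewrite (bigD1_seq j) ?mem_index_iota ?iota_uniq//= eqxx big1 ?addr0// => i ij.
  by rewrite (negbTE ij) mulr0.
rewrite big_nat big1// => i min; case: eqP => [ij|]; last by rewrite mulr0.
by move: min mjn; rewrite ij => ->.
Qed.

Lemma nm_ons_sum (c : nat -> C) m n :
  nm (\sum_(m <= i < n) c i *: e i) ^+ 2 = \sum_(m <= i < n) nm (c i) ^+ 2 * (e i != 0)%:R.
Proof.
apply: (@complexI R); rewrite -(dotxx hdot) dot_sumr rmorph_sum /=.
apply: eq_big_nat => j mjn; rewrite dotZr dot_ons_sum mjn.
by rewrite mulrA [_^* * _]mulrC mulJ (rmorphM _ (nm (c j) ^+ 2)) (rmorph_nat (real_complex R)).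
Qed.

Lemma nm_ons_sum_le (c : nat -> C) m n :
  nm (\sum_(m <= i < n) c i *: e i) ^+ 2 <= \sum_(m <= i < n) nm (c i) ^+ 2.
Proof.
rewrite nm_ons_sum ler_sum// => i _.
by case: (e i != 0); rewrite ?mulr1// mulr0 sqr_ge0.
Qed.

Lemma dot_ons_zero x i : dot x (e i) * (e i != 0)%:R = dot x (e i).
Proof. by case: eqVneq => [->|_]; rewrite ?dot0r ?mulr1 ?mul0r. Qed.

Definition proj n x := \sum_(0 <= i < n) dot x (e i) *: e i.

Lemma dot_proj x n j : (j < n)%N -> dot (proj n x) (e j) = dot x (e j).
Proof. by move=> jn; rewrite dot_ons_sum jn dot_ons_zero. Qed.

Lemma nm_proj x n : nm (proj n x) ^+ 2 = \sum_(0 <= i < n) nm (dot x (e i)) ^+ 2.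
Proof.
rewrite nm_ons_sum; apply: eq_bigr => i _.
by case: eqVneq => [->|_]; rewrite ?dot0r ?nm0 ?mulr1 // mulr0 expr0n.
Qed.

Lemma dot_proj_proj x n : dot (proj n x) (x - proj n x) = 0.
Proof.
rewrite dot_suml big_nat big1// => j /andP[_ jn].
by rewrite dotZl (dotC _ (e j)) dotBl dot_proj// subrr conjc0 mulr0.
Qed.

Lemma nm_sq_proj x n : nm x ^+ 2 = nm (proj n x) ^+ 2 + nm (x - proj n x) ^+ 2.
Proof.
by rewrite -{1}(subrKC (proj n x) x) (nm_sqD hdot (proj n x)) dot_proj_proj mulr0 addr0.
Qed.

Lemma Bessel x n : \sum_(0 <= i < n) nm (dot x (e i)) ^+ 2 <= nm x ^+ 2.
Proof. by rewrite -nm_proj (nm_sq_proj x n) lerDl sqr_ge0. Qed.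

Lemma nm_proj_le x n : nm (proj n x) <= nm x.
Proof. by rewrite -ler_sqr ?nnegrE ?nm_ge0// nm_proj Bessel. Qed.

Lemma nm_coproj_le x n : nm (x - proj n x) <= nm x.
Proof. by rewrite -ler_sqr ?nnegrE ?nm_ge0// (nm_sq_proj x n) lerDr sqr_ge0. Qed.

Lemma proj_linear n : linear (proj n).
Proof.
move=> a x y; rewrite /proj scaler_sumr -big_split; apply: eq_bigr => i _ /=.
by rewrite dotDl dotZl scalerDl scalerA.
Qed.

(** By Pythagoras, the squared distance of two partial sums is at most a block of the convergent
    series of |c i|^2. *)
Lemma riesz_fischer (c : nat -> C) L :
  (forall n, \sum_(0 <= i < n) nm (c i) ^+ 2 <= L) ->
  exists x, tends (fun n => \sum_(0 <= i < n) c i *: e i) x.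
Proof.
move=> cL; apply: (cauchy_tends).
pose S n := \sum_(0 <= i < n) nm (c i) ^+ 2.
have Smono : {homo S : n m / (n <= m)%N >-> n <= m}.
  move=> n m nm; rewrite /S [leRHS](@big_cat_nat _ _ _ n)//= lerDl sumr_ge0// => i _.
  exact: sqr_ge0.
have /cvg_ex[l /= Sl] : cvg (S @ \oo).
  by apply: nondecreasing_is_cvgn => //; exists L => _ [n _ <-]; exact: cL.
move=> r r0; have r2 : 0 < r ^+ 2 / 2 by rewrite divr_gt0 ?exprn_gt0.
have /cvgrPdist_lt/(_ _ r2)[N _ HN] := Sl.
exists N => m n Nm mn.
have -> : \sum_(0 <= i < n) c i *: e i = \sum_(0 <= i < m) c i *: e i + \sum_(m <= i < n) c i *: e i.
  by rewrite -big_cat_nat.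
rewrite addrC addKr.
rewrite -ltr_sqr ?nnegrE ?nm_ge0 ?ltW// (le_lt_trans (nm_ons_sum_le _ _ _))//.
have := HN _ Nm; have := HN _ (leq_trans Nm mn).
have -> : S n = S m + \sum_(m <= i < n) nm (c i) ^+ 2 by rewrite /S -big_cat_nat.
rewrite !ltr_norml; lra.
Qed.

End Orthonormal.

(** * Orthonormal bases and existence of adjoints *)

Section Basis.
Variables (R : realType) (H : completeNormedModType R[i]).
Variable dot : {dot H for Num.conj}.
Hypothesis hdot : hilbert_dot dot.
Local Notation C := R[i].
Implicit Types (x y z : H) (T S : H -> H).

Definition total_ons (h : nat -> H) :=
  ons dot h /\ forall x, tends (fun n => proj dot h n x) x.

Section GramSchmidt.
Variable d : nat -> H.

Let residue (s : seq H) x := x - \sum_(v <- s) dot x v *: v.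
(** As 0^-1 = 0, a vector [d n] that depends on the earlier ones yields the zero vector, which [ons]
    allows; no subsequence has to be extracted. *)
Let unitv x := ((nm x)^-1)%:C *: x.
Fixpoint gs_list n :=
  if n is n'.+1 then rcons (gs_list n') (unitv (residue (gs_list n') (d n'))) else [::].
Definition gs n := unitv (residue (gs_list n) (d n)).

Lemma big_gs_list (F : H -> H) n : \sum_(v <- gs_list n) F v = \sum_(0 <= i < n) F (gs i).
Proof.
elim: n => [|n IH]; first by rewrite big_nil big_geq.
by rewrite /= big_rcons /= IH big_nat_recr//= addrC.
Qed.

Lemma gsE n : gs n = unitv (d n - proj dot gs n (d n)).
Proof. by rewrite /gs /residue big_gs_list. Qed.

Lemma dot_unitv x : dot (unitv x) (unitv x) = (unitv x != 0)%:R.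
Proof.
rewrite /unitv; have [->|x0] := eqVneq x 0; first by rewrite scaler0 dot0l eqxx.
have nx : nm x != 0 by rewrite nm_eq0.
have e0 : ((nm x)^-1)%:C != 0 :> C.
  by rewrite -(rmorph0 (real_complex R)) (inj_eq (@complexI R)) invr_eq0.
rewrite scaler_eq0 negb_or e0 x0 /= (dotxx hdot) nmZ nmR ger0_norm ?invr_ge0 ?nm_ge0//.
by rewrite mulVf// expr1n.
Qed.

Lemma gs_ons : ons dot gs.
Proof.
suff H1 n : forall i j, (i < n)%N -> (j < n)%N ->
    dot (gs i) (gs j) = ((i == j) && (gs i != 0))%:R.
  by move=> i j; apply: (H1 (maxn i j).+1); rewrite ltnS ?leq_maxl ?leq_maxr.
elim: n => // n IH.
have orth i : (i < n)%N -> dot (gs n) (gs i) = 0.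
  move=> im; rewrite gsE dotZl dotBl dot_suml.
  rewrite (bigD1_seq i) ?mem_index_iota ?iota_uniq//= dotZl IH// eqxx /=.
  rewrite big_nat_cond big1 ?addr0 ?dot_ons_zero ?subrr ?mulr0// => j /andP[/andP[_ jn] ji].
  by rewrite dotZl IH// (negbTE ji) mulr0.
move=> i j; rewrite !ltnS leq_eqVlt => /predU1P[->|im]; rewrite leq_eqVlt => /predU1P[->|jm].
- by rewrite eqxx /= dot_unitv.
- by rewrite orth// gtn_eqF.
- by rewrite dotC orth// conjc0 ltn_eqF.
- exact: IH.
Qed.

Lemma gs_span m n : (m < n)%N -> proj dot gs n (d m) = d m.
Proof.
have key : d m - proj dot gs m (d m) = (nm (d m - proj dot gs m (d m)))%:C *: gs m.
  rewrite gsE; set w := d m - _; rewrite /unitv scalerA -rmorphM /=.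
  have [->|w0] := eqVneq w 0; first by rewrite scaler0.
  by rewrite mulfV ?nm_eq0// scale1r.
set k := (nm _)%:C in key.
have dk : dot (d m) (gs m) = k * (gs m != 0)%:R.
  rewrite -{1}(subrK (proj dot gs m (d m)) (d m)) key dotDl dotZl gs_ons eqxx /=.
  by rewrite (dot_ons_sum gs_ons) ltnn addr0.
have dkk : dot (d m) (gs m) *: gs m = k *: gs m.
  by rewrite dk; case: eqVneq => [->|_]; rewrite ?scaler0 ?mulr1.
have E : d m = \sum_(0 <= i < m.+1) dot (d m) (gs i) *: gs i.
  by rewrite big_nat_recr//= dkk -key addrC subrK.
move=> mn; rewrite /proj (@big_cat_nat _ _ _ m.+1)//= -E big_nat big1 ?addr0// => i /andP[mi _].
rewrite (_ : dot (d m) (gs i) = 0) ?scale0r//.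
by rewrite {1}E (dot_ons_sum gs_ons) ltnNge mi.
Qed.

(** The projections are contractions that eventually fix [d m], so an e / 2 approximation of x by
    [d m] costs e / 2 twice. *)
Lemma gs_total : (forall x e, 0 < e -> exists m, nm (x - d m) < e) -> total_ons gs.
Proof.
move=> dense_d; split; first exact: gs_ons.
move=> x; apply/tendsP => e e0; have [m xm] := dense_d x (e / 2) ltac:(lra).
exists m.+1 => n mn; rewrite (_ : _ - x = proj dot gs n (x - d m) - (x - d m)); last first.
  by rewrite (linopB (proj_linear dot gs n)) gs_span// opprB addrA subrK.
rewrite (le_lt_trans (nmD _ _))// nmN.
by have := nm_proj_le hdot gs_ons (x - d m) n; lra.
Qed.

End GramSchmidt.

Lemma total_ons_exists : separable_space H -> exists h, total_ons h.
Proof.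
move=> [D [/pcard_leP[f] Dd]].
(* As [f] is injective on D, [d] inverts it there; the indices that [f] misses receive 0. *)
pose d n := xget (0 : H) [set x | D x /\ f x = n].
exists (gs d); apply: gs_total => x e e0.
have [y [Dy xy]] : exists y, D y /\ nm (x - y) < e.
  have e0' : 0 < e%:C :> C by rewrite ltcR.
  have [||y [/interior_subset xy Dy]] := Dd (interior (ball x e%:C)).
  - by exists x; exact: nbhsx_ballx.
  - exact: open_interior.
  - by exists y; split=> //; move: xy; rewrite -ball_normE /= nmE ltcR.
exists (f y); rewrite (_ : d (f y) = y)// /d.
case: xgetP => [z _ [Dz]|/(_ y)[]//].
by apply: (@inj _ _ _ f); rewrite inE.
Qed.

(** Relational form of [adjoint]: a witness can be carried along and composed, and [adjointE]
    evaluates the choice at the end. *)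
Definition is_adj T S := bounded_op S /\ forall x y, dot (T x) y = dot x (S y).

Lemma is_adj_uniq T S S' : is_adj T S -> is_adj T S' -> S = S'.
Proof.
move=> [_ hS] [_ hS']; apply/funext => y; apply: (dot_eqP hdot) => x.
by rewrite -hS -hS'.
Qed.

Lemma is_adj_sym T S : bounded_op T -> is_adj T S -> is_adj S T.
Proof. by move=> bT [bS hS]; split=> // x y; rewrite dotC -hS -dotC. Qed.

Lemma is_adj_comp T T' S S' : is_adj T T' -> is_adj S S' -> is_adj (T \o S) (S' \o T').
Proof.
move=> [bT hT] [bS hS]; split; first exact: bop_comp.
by move=> x y /=; rewrite hT hS.
Qed.

Lemma adjointE T S : is_adj T S -> adjoint dot T = S.
Proof.
move=> TS; rewrite /adjoint; case: xgetP => [S' _ TS'|/(_ S)//].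
exact: is_adj_uniq TS' TS.
Qed.

(** Cauchy-Schwarz applied to |S y|^2 = <T S y, y>. It is also what makes the operator built in
    [adj_exists] bounded. *)
Lemma is_adj_bound T S c : 0 <= c -> (forall x, nm (T x) <= c * nm x) ->
  (forall x y, dot (T x) y = dot x (S y)) -> forall y, nm (S y) <= c * nm y.
Proof.
move=> c0 Tc TS y; have [->|y0] := eqVneq (S y) 0; first by rewrite nm0 mulr_ge0 ?nm_ge0.
have : nm (S y) ^+ 2 <= c * nm (S y) * nm y.
  have -> : nm (S y) ^+ 2 = nm (dot (T (S y)) y).
    by rewrite TS (dotxx hdot) nmR ger0_norm// sqr_ge0.
  by rewrite (le_trans (CauchySchwarz hdot _ _))// ler_wpM2r ?nm_ge0.
rewrite -mulrA mulrCA expr2 ler_pM2l// lt_def nm_eq0 y0 nm_ge0//.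
Qed.

Lemma linear_adj T S : (forall x y, dot (T x) y = dot x (S y)) -> linear S.
Proof.
move=> TS a x y; apply: (dot_eqP hdot) => z.
by rewrite -TS !dotDr !dotZr -!TS.
Qed.

(** In a basis h the adjoint must be S y = sum_k <y, T h_k> h_k; Riesz-Fischer gives its
    convergence. *)
Lemma adj_exists T : separable_space H -> bounded_op T -> exists S, is_adj T S.
Proof.
move=> /total_ons_exists[h [oh th]] bT; have [lT _] := bT.
have [c c0 Tc] := bop_bound bT.
have ex y : exists z, tends (fun n => \sum_(0 <= k < n) dot y (T (h k)) *: h k) z.
  apply: (@riesz_fischer _ _ _ hdot h oh _ ((c * nm y) ^+ 2)) => n.
  (* The sum s of squared coefficients equals <y, T z>, hence |z|^2 <= s <= c |y| |z|. So |z| <= c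
     |y|, and s <= (c |y|)^2 follows. *)
  set z := \sum_(0 <= k < n) dot y (T (h k)) *: h k.
  have E : dot y (T z) = (\sum_(0 <= k < n) nm (dot y (T (h k))) ^+ 2)%:C.
    rewrite (linop_sum lT) dot_sumr rmorph_sum /=; apply: eq_bigr => k _.
    by rewrite (linopZ lT) dotZr mulrC mulJ.
  have := CauchySchwarz hdot y (T z); rewrite E nmR.
  set s := \sum_(_ <= k < _) _.
  have s0 : 0 <= s by rewrite sumr_ge0// => k _; exact: sqr_ge0.
  rewrite ger0_norm// => h1.
  have h2 : nm z ^+ 2 <= s by exact: nm_ons_sum_le.
  have h3 : s <= c * nm y * nm z.
    by rewrite (le_trans h1)// (mulrC c) -mulrA ler_wpM2l ?nm_ge0.
  have a0 : 0 <= c * nm y by rewrite mulr_ge0 ?nm_ge0.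
  rewrite (le_trans h3)// expr2 ler_wpM2l// leNgt; apply/negP => az.
  have := le_trans h2 h3; rewrite expr2 ler_pM2r ?leNgt ?az//.
  exact: le_lt_trans az.
pose S y := xget 0 [set z | tends (fun n => \sum_(0 <= k < n) dot y (T (h k)) *: h k) z].
have SP y : tends (fun n => \sum_(0 <= k < n) dot y (T (h k)) *: h k) (S y).
  have [z hz] := ex y; rewrite /S; case: xgetP => // /(_ z); exact.
have TS x y : dot (T x) y = dot x (S y).
  apply: (@tends_unique _ _ (fun n => dot (T (proj dot h n x)) y)).
    by apply: tends_dotl => //; exact: tends_op.
  have := tends_dotr hdot x (SP y); apply: tends_eq => n.
  rewrite (linop_sum lT) dot_suml dot_sumr; apply: eq_bigr => k _.
  by rewrite (linopZ lT) dotZl dotZr mulrC (dotC _ (T _)).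
exists S; split=> //; apply/bounded_opP; split; first exact: (linear_adj TS).
by exists c => //; exact: is_adj_bound TS.
Qed.

End Basis.

(** * Diagonal operators *)

Section Diagonal.
Variables (R : realType) (H : completeNormedModType R[i]).
Variable dot : {dot H for Num.conj}.
Hypothesis hdot : hilbert_dot dot.
Local Notation C := R[i].
Implicit Types (x y z : H) (T S K : H -> H) (c : nat -> R) (a b : nat -> H).

Definition diag_sum c a b n x := \sum_(0 <= k < n) ((c k)%:C * dot x (a k)) *: b k.

(** Strong convergence of sum_k c_k <., a_k> b_k. Adjoints exchange [a] and [b]; powers of the
    modulus change only [c]. *)
Definition diag K c a b := forall x, tends (fun n => diag_sum c a b n x) (K x).

Section Bounded.
Variables (c : nat -> R) (a b : nat -> H) (L : R).
Hypotheses (oa : ons dot a) (ob : ons dot b) (L0 : 0 <= L).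

Lemma nm_sq_diag_sum n x : nm (diag_sum c a b n x) ^+ 2 <=
  \sum_(0 <= k < n) (c k ^+ 2) * nm (dot x (a k)) ^+ 2.
Proof.
rewrite (le_trans (nm_ons_sum_le hdot ob _ _ _))// ler_sum// => k _.
by rewrite nmM nmR exprMn real_normK ?num_real.
Qed.

Hypothesis cL : forall k, `|c k| <= L.

Lemma sq_coef_le n x :
  \sum_(0 <= k < n) (c k ^+ 2) * nm (dot x (a k)) ^+ 2 <= (L * nm x) ^+ 2.
Proof.
apply: le_trans (_ : \sum_(0 <= k < n) L ^+ 2 * nm (dot x (a k)) ^+ 2 <= _).
  apply: ler_sum => k _; rewrite ler_wpM2r ?sqr_ge0//.
  by rewrite -real_normK ?num_real// ler_sqr ?nnegrE.
by rewrite -mulr_sumr exprMn ler_wpM2l ?sqr_ge0// (Bessel hdot oa).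
Qed.

Lemma nm_diag_sum n x : nm (diag_sum c a b n x) <= L * nm x.
Proof.
rewrite -ler_sqr ?nnegrE ?nm_ge0 ?mulr_ge0 ?nm_ge0//.
exact: le_trans (nm_sq_diag_sum _ _) (sq_coef_le _ _).
Qed.

Lemma diag_linear K : diag K c a b -> linear K.
Proof.
move=> hK r x y; apply: (tends_unique (hK _)).
have := tendsD (tendsZ r (hK x)) (hK y); apply: tends_eq => n.
rewrite /diag_sum scaler_sumr -big_split; apply: eq_bigr => k _ /=.
by rewrite dotDl dotZl scalerA -scalerDl; congr (_ *: _); ring.
Qed.

Lemma diag_bop K : diag K c a b -> bounded_op K.
Proof.
move=> hK; apply/bounded_opP; split; first exact: diag_linear.
by exists L => // x; apply: (tends_bound _ (hK x)) => n; exact: nm_diag_sum.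
Qed.

Lemma diag_exists : exists K, diag K c a b.
Proof.
have ex x : exists y, tends (fun n => diag_sum c a b n x) y.
  apply: (riesz_fischer hdot ob (L := (L * nm x) ^+ 2)) => n.
  apply: le_trans (sq_coef_le n x); rewrite ler_sum// => k _.
  by rewrite nmM nmR exprMn real_normK ?num_real.
exists (fun x => xget 0 [set y | tends (fun n => diag_sum c a b n x) y]) => x.
by have [y hy] := ex x; case: xgetP => // /(_ y); exact.
Qed.

End Bounded.

Lemma diag_adj K K' c a b : diag K c a b -> diag K' c b a ->
  forall x y, dot (K x) y = dot x (K' y).
Proof.
move=> hK hK' x y; apply: (tends_unique (tends_dotl hdot y (hK x))).
have := tends_dotr hdot x (hK' y); apply: tends_eq => n.
rewrite dot_suml dot_sumr; apply: eq_bigr => k _.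
by rewrite dotZl -scalerA dotZrR dotZr (dotC _ (b k)) mulrAC -mulrA.
Qed.

Lemma diag_on_vec K c a b i : ons dot a -> diag K c a b ->
  K (a i) = ((c i)%:C * (a i != 0)%:R) *: b i.
Proof.
move=> oa hK; apply: (tends_unique (hK (a i))).
apply/tendsP => e e0; exists i.+1 => n ni.
rewrite /diag_sum (bigD1_seq i) ?mem_index_iota ?iota_uniq//=.
rewrite oa eqxx /= big1 ?addr0 ?subrr ?nm0// => j ji.
by rewrite oa eq_sym (negbTE ji) mulr0 scale0r.
Qed.

Lemma dot_diag_vec K c a b x i : ons dot b -> diag K c a b ->
  dot (K x) (b i) = (c i)%:C * dot x (a i) * (b i != 0)%:R.
Proof.
move=> ob hK; apply: (tends_unique (tends_dotl hdot (b i) (hK x))).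
by apply/tendsP => e e0; exists i.+1 => n ni; rewrite (dot_ons_sum ob) ni subrr nm0.
Qed.

Lemma diag_zero K c a b x : diag K c a b -> (forall i, dot x (a i) = 0) -> K x = 0.
Proof.
move=> hK x0; apply: (tends_unique (hK x)); apply: tends_eq (tends_cst _) => n.
by rewrite /diag_sum big1// => i _; rewrite x0 mulr0 scale0r.
Qed.

Lemma diag_proj K e : ons dot e -> diag K (fun=> 1) e e ->
  forall x, tends (fun n => proj dot e n x) (K x).
Proof. by move=> oe hK x; apply: tends_eq (hK x) => n; apply: eq_bigr => k _; rewrite mul1r. Qed.

Lemma diag_proj_exists e : ons dot e -> exists P, forall x,
  tends (fun n => proj dot e n x) (P x) /\ forall i, dot (x - P x) (e i) = 0.
Proof.
move=> oe; have [||P hP] := @diag_exists (fun=> 1) e e 1 oe oe => //.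
  by move=> _; rewrite normr1.
exists P => x; split; first exact: diag_proj.
by move=> i; rewrite dotBl (dot_diag_vec _ _ oe hP) mul1r dot_ons_zero subrr.
Qed.

(** Every vector splits along the closed span of e and its orthogonal complement. This is how
    operators chosen by [xget] are identified. *)
Lemma bop_ext e S T : ons dot e -> bounded_op S -> bounded_op T ->
  (forall i, S (e i) = T (e i)) ->
  (forall x, (forall i, dot x (e i) = 0) -> S x = T x) -> S = T.
Proof.
move=> oe bS bT Se S0; apply/funext => x; have [lS _] := bS; have [lT _] := bT.
have [P /(_ x)[Px P0]] := diag_proj_exists oe.
rewrite -(subrK (P x) x) (linopD lS) (linopD lT) S0//; congr (_ + _).
apply: (tends_unique (tends_op bS Px)); apply: tends_eq (tends_op bT Px) => n.
rewrite (linop_sum lS) (linop_sum lT); apply: eq_bigr => k _.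
by rewrite (linopZ lS) (linopZ lT) Se.
Qed.

End Diagonal.

(** * Singular value expansion of compact operators *)

(** Needed for deflation, where each singular vector is chosen from all the earlier ones. *)
Lemma history_recursion (A : Type) (F : seq A -> A) : exists e : nat -> A, forall n, e n = F (mkseq e n).
Proof.
pose l := fix l n := if n is m.+1 then rcons (l m) (F (l m)) else [::].
exists (fun n => F (l n)) => n; congr F.
by elim: n => //= n IH; rewrite mkseqS -IH.
Qed.

Section SVD.
Variables (R : realType) (H : completeNormedModType R[i]).
Variable dot : {dot H for Num.conj}.
Hypothesis hdot : hilbert_dot dot.
Local Notation C := R[i].
Implicit Types (x y z : H) (T S : H -> H) (s : nat -> R) (e f : nat -> H).

(** A cluster point rather than a convergent subsequence: this comes directly from the filter form
    of compactness, and close terms can be picked beyond any index. *)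
Definition seqcompact T := forall u : nat -> H, (forall n, nm (u n) <= 1) ->
  exists y, forall r, 0 < r -> forall N, exists n, (N <= n)%N /\ nm (T (u n) - y) < r.

Lemma compact_op_seqcompact T : compact_op T -> seqcompact T.
Proof.
move=> [_]; rewrite precompactE => cT u u1.
have pF : ProperFilter ((T \o u) @ \oo) by exact: fmap_proper_filter.
have [|y [_ Fy]] := cT _ pF.
  exists 0%N => // n _; apply: subset_closure; exists (u n) => //=.
  by rewrite nmE (lecR _ 1).
exists y => r r0 N.
have r0' : 0 < r%:C :> C by rewrite ltcR.
have [||_ [[n /= Nn <-] /=]] := Fy ((T \o u) @` [set n | (N <= n)%N]) (ball y r%:C).
- by exists N => // n /= Nn; exists n.
- exact: nbhsx_ballx.
- by rewrite -ball_normE /= nmE ltcR nmB => h; exists n.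
Qed.

Lemma seqcompact_comp S T : linear S -> seqcompact S -> bounded_op T -> seqcompact (S \o T).
Proof.
move=> lS cS bT u u1; have [c c0 Tc] := bop_bound1 bT.
have ci : nm ((c^-1)%:C : C) = c^-1 by rewrite nmR ger0_norm// invr_ge0 ltW.
have [|y hy] := cS (fun n => (c^-1)%:C *: T (u n)).
  move=> n; rewrite nmZ ci mulrC ler_pdivrMr// mul1r (le_trans (Tc _))//.
  by rewrite ler_piMr// ltW.
exists (c%:C *: y) => r r0 N; have [|n [Nn h]] := hy (r / c) _ N; first exact: divr_gt0.
exists n; split=> //=.
rewrite (_ : S (T (u n)) = c%:C *: S ((c^-1)%:C *: T (u n))); last first.
  by rewrite (linopZ lS) scalerA -rmorphM /= divff ?gt_eqF// scale1r.
by rewrite -scalerBr nmZ nmR ger0_norm ?ltW// mulrC -ltr_pdivlMr.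
Qed.

Section Top.
Variables (T T' : H -> H).
Hypotheses (bT : bounded_op T) (aT : is_adj dot T T') (cT : seqcompact T).

(** Here l is the operator norm of T. For T = 0 the vector v is 0, in line with the zero vectors of
    [ons]. *)
Definition top_vector v (l : R) := [/\ 0 <= l, forall x, nm (T x) <= l * nm x,
  nm v = (0 < l)%R%:R & T' (T v) = (l ^+ 2)%:C *: v].

(* If T nearly attains its norm l along unit vectors w n, then T' T (w n) - l^2 w n
   tends to 0, so that w n converges as soon as T (w n) does. *)
Lemma top_vector_exists : exists v l, top_vector v l.
Proof.
have [lT _] := bT; have [bT' adjT] := aT; have [lT' _] := bT'.
have [c c0 Tc] := bop_bound bT.
pose E := [set nm (T x) | x in [set x | nm x <= 1]].
have E0 : E (nm (T 0)) by exists 0 => //=; rewrite nm0.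
have Eub : ubound E c.
  by move=> _ [x /= x1 <-]; rewrite (le_trans (Tc _))// ler_piMr.
have hE : has_sup E by split; [exists (nm (T 0))|exists c].
pose l := sup E.
have Tl1 x : nm x <= 1 -> nm (T x) <= l by move=> x1; apply: ub_le_sup; [exists c|exists x].
have l0 : 0 <= l by rewrite (le_trans (nm_ge0 (T 0)))// Tl1// nm0.
have Tl x : nm (T x) <= l * nm x.
  have [->|x0] := eqVneq x 0; first by rewrite (linop0 lT) nm0 mulr0.
  have nx : 0 < nm x by rewrite lt_def nm_eq0 x0 nm_ge0.
  have : nm (T (((nm x)^-1)%:C *: x)) <= l.
    by rewrite Tl1// nmZ nmR ger0_norm ?mulVf ?gt_eqF// invr_ge0 (ltW nx).
  by rewrite (linopZ lT) nmZ nmR ger0_norm ?invr_ge0 ?(ltW nx)// [_^-1 * _]mulrC ler_pdivrMr.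
have T'l := is_adj_bound hdot l0 Tl adjT.
have [lz|ln0] := eqVneq l 0.
  exists 0, 0; split=> //; first by move=> x; have := Tl x; rewrite lz.
    by rewrite nm0 ltxx.
  by rewrite (linop0 lT) (linop0 lT') scaler0.
have lp : 0 < l by rewrite lt_def ln0.
have [u hu] : {u : nat -> H & forall n, nm (u n) <= 1 /\ l - n.+1%:R^-1 < nm (T (u n))}.
  apply: (@choice _ _ (fun n x => nm x <= 1 /\ l - n.+1%:R^-1 < nm (T x))) => n.
  have n0 : 0 < n.+1%:R^-1 :> R by rewrite invr_gt0.
  by have [_ [x /= x1 <-] h] := sup_adherent n0 hE; exists x.
have [y hy] := cT (fun n => (hu n).1).
have [k hk] : {k : nat -> nat & forall n, (n <= k n)%N /\ nm (T (u (k n)) - y) < n.+1%:R^-1}.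
  apply: (@choice _ _ (fun n m => (n <= m)%N /\ nm (T (u m) - y) < n.+1%:R^-1)) => n.
  by apply: hy; rewrite invr_gt0.
pose w n := u (k n).
have Twy : tends (fun n => T (w n)) y.
  by apply: (tends_squeeze (a := fun n => n.+1%:R^-1)); [move=> n; rewrite ltW// (hk n).2|exact: cvg_harmonic].
have w1 n : nm (w n) <= 1 by exact: (hu _).1.
have Twl : (fun n => nm (T (w n))) @ \oo --> l.
  have h : (fun n => l - n.+1%:R^-1) @ \oo --> l.
    by rewrite -[X in _ --> X]subr0; apply: cvgB; [exact: cvg_cst|exact: cvg_harmonic].
  apply: (squeeze_cvgr _ h (cvg_cst l)); apply: nearW => n; rewrite Tl1// andbT.
  rewrite (le_trans _ (ltW (hu _).2))// lerD2l lerN2 lef_pV2 ?posrE// ler_nat ltnS.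
  exact: (hk n).1.
have nyl : nm y = l by exact: (cvg_unique _ (tends_nm Twy) Twl).
have TTw := tends_op bT' Twy.
have wTT : tends (fun n => T' (T (w n)) - (l ^+ 2)%:C *: w n) 0.
  (* Expand the square: the cross term is -2 l^2 |T w|^2, and the two squares are at most l^2 |T
     w|^2 and l^4. *)
  have key n : nm (T' (T (w n)) - (l ^+ 2)%:C *: w n) ^+ 2 <= l ^+ 2 * (l ^+ 2 - nm (T (w n)) ^+ 2).
    rewrite (nm_sqD hdot) nmN nmZ nmR ger0_norm ?sqr_ge0// dotNr dotZrR cReN cReMl.
    rewrite (is_adj_sym bT aT).2 (dotxx hdot) /=.
    have h1 : nm (T' (T (w n))) ^+ 2 <= (l * nm (T (w n))) ^+ 2.
      by rewrite ler_sqr ?nnegrE ?mulr_ge0 ?nm_ge0.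
    have h2 : (l ^+ 2 * nm (w n)) ^+ 2 <= (l ^+ 2) ^+ 2.
      by rewrite ler_sqr ?nnegrE ?mulr_ge0 ?nm_ge0 ?sqr_ge0// ler_piMr ?sqr_ge0.
    by move: h1; rewrite exprMn; lra.
  have c2 : (fun n => l ^+ 2 * (l ^+ 2 - nm (T (w n)) ^+ 2)) @ \oo --> (0 : R).
    rewrite -[X in _ --> X](mulr0 (l ^+ 2)) -(subrr (l ^+ 2)).
    by apply: cvgMr; apply: cvgB; [exact: cvg_cst|apply: cvgM].
  apply/tendsP => r r0; have r2 : 0 < r ^+ 2 by rewrite exprn_gt0.
  have /cvgrPdist_lt/(_ _ r2)[N _ HN] := c2.
  exists N => n /HN /=; rewrite sub0r normrN subr0 => h.
  rewrite -ltr_sqr ?nnegrE ?nm_ge0 ?ltW// (le_lt_trans (key n))//.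
  exact: le_lt_trans (ler_norm _) h.
(* T' T (w n) tends to T' y and differs from l^2 w n by a null sequence, so v is the only possible
   limit of w. *)
pose v := ((l ^+ 2)^-1)%:C *: T' y.
have l2 : l ^+ 2 != 0 by rewrite expf_neq0.
have vE : (l ^+ 2)%:C *: v = T' y by rewrite scalerA -rmorphM /= mulfV// scale1r.
have wv : tends w v.
  have := tendsZ ((l ^+ 2)^-1)%:C (tendsB TTw wTT).
  rewrite subr0; apply: tends_eq => n.
  by rewrite opprB addrC subrK scalerA -rmorphM /= mulVf// scale1r.
have Tv : T v = y by exact: tends_unique (tends_op bT wv) Twy.
have v1 : nm v <= 1 by exact: tends_bound wv.
exists v, l; split=> //; last by rewrite Tv vE.
rewrite lp; apply/eqP; rewrite eq_le v1 /=.
by have := Tl v; rewrite Tv nyl -{1}[l]mulr1 ler_pM2l.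
Qed.

End Top.

(** Vectors vanish exactly where s does, so that finite rank is no separate case. Convergence of s
    to 0 makes every positive level finite. *)
Record svd T s e f : Prop := Svd {
  svd_ge0 : forall k, 0 <= s k;
  svd_cvg : s @ \oo --> (0 : R);
  svd_onsl : ons dot e;
  svd_onsr : ons dot f;
  svd_e0 : forall k, (e k != 0) = (0 < s k);
  svd_f0 : forall k, (f k != 0) = (0 < s k);
  svd_diag : diag dot T s e f }.

Lemma bop_fin_proj e n : bounded_op (proj dot e n).
Proof.
elim: n => [|n IH].
  by rewrite (_ : proj _ _ _ = fun=> 0); [exact: bop_zero|apply/funext => x; rewrite /proj big_geq].
rewrite (_ : proj dot e n.+1 = fun x => proj dot e n x + dot x (e n) *: e n).
  by apply: bop_add => //; exact: bop_rank1.
by apply/funext => x; rewrite /proj big_nat_recr.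
Qed.

Lemma dot_proj_sym e n x y : dot (proj dot e n x) y = dot x (proj dot e n y).
Proof.
rewrite dot_suml dot_sumr; apply: eq_bigr => k _.
by rewrite dotZl dotZr mulrC (dotC _ (e k)).
Qed.


(* Deflation: e n is a top singular vector of T restricted to the orthogonal of
   e 0, ..., e (n - 1). *)
Lemma svd_exists T T' : bounded_op T -> is_adj dot T T' -> seqcompact T ->
  exists s e f, svd T s e f.
Proof.
move=> bT aT cT; have [lT _] := bT; have [bT' adjT] := aT; have [lT' _] := bT'.
pose F (l : seq H) x := x - \sum_(v <- l) dot x v *: v.
pose F' (l : seq H) x := T' x - \sum_(v <- l) dot (T' x) v *: v.
(* The default 0 is never taken: [top_vector_exists] applies to every deflated operator. *)
pose tv l := xget 0 [set v | exists r, top_vector (T \o F l) (F' l) v r].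
have [e he] := history_recursion tv.
pose Q n x := x - proj dot e n x.
have bQ n : bounded_op (Q n) by apply: bop_sub; [exact: bop_id|exact: bop_fin_proj].
have Qadj n : is_adj dot (Q n) (Q n).
  by split=> // x y; rewrite /Q dotBl dotBr dot_proj_sym.
have FQ n : F (mkseq e n) = Q n.
  by apply/funext => x; rewrite /F /Q /proj /mkseq big_map -/(index_iota 0 n) /index_iota subn0.
have F'Q n : F' (mkseq e n) = Q n \o T'.
  by apply/funext => x; rewrite /F' /Q /proj /mkseq big_map /index_iota subn0.
have [s hs] : {s : nat -> R & forall n, top_vector (T \o Q n) (Q n \o T') (e n) (s n)}.
  apply: (@choice _ _ (fun n r => top_vector (T \o Q n) (Q n \o T') (e n) r)) => n.
  rewrite he /tv FQ F'Q; case: xgetP => // none.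
  have [v [r vr]] := top_vector_exists (bop_comp bT (bQ n)) (is_adj_comp aT (Qadj n))
    (seqcompact_comp lT cT (bQ n)).
  by case: (none v); exists r.
have s0 n : 0 <= s n by case: (hs n).
have ne n : nm (e n) = (0 < s n)%R%:R by case: (hs n).
have Tle n x : nm (T (Q n x)) <= s n * nm x by case: (hs n) => _ /(_ x).
have eig n : Q n (T' (T (Q n (e n)))) = (s n ^+ 2)%:C *: e n by case: (hs n).
have e0 n : (e n != 0) = (0 < s n).
  by rewrite -nm_eq0 ne; case: (0 < s n); rewrite ?oner_eq0 ?eqxx.
have Qe n i : (forall j k, (j < n)%N -> (k < n)%N -> dot (e j) (e k) = ((j == k) && (e j != 0))%:R) ->
    (i < n)%N -> Q n (e i) = 0.
  move=> H1 im; rewrite /Q /proj (bigD1_seq i) ?mem_index_iota ?iota_uniq//= H1// eqxx /=.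
  rewrite big_nat_cond big1 ?addr0.
    by case: eqVneq => [->|_]; rewrite ?scaler0 ?scale1r subrr.
  by move=> j /andP[/andP[_ jn] ji]; rewrite H1// eq_sym (negbTE ji) scale0r.
have oe : ons dot e.
  suff H1 n : forall i j, (i < n)%N -> (j < n)%N ->
      dot (e i) (e j) = ((i == j) && (e i != 0))%:R.
    by move=> i j; apply: (H1 (maxn i j).+1); rewrite ltnS ?leq_maxl ?leq_maxr.
  elim: n => // n IH.
  (* A nonzero e n lies in the range of the self-adjoint Q n, which annihilates e i. *)
  have orth i : (i < n)%N -> dot (e n) (e i) = 0.
    move=> im; have [en0|en0] := eqVneq (e n) 0; first by rewrite en0 dot0l.
    have sn : s n ^+ 2 != 0 by rewrite expf_neq0// gt_eqF// -e0.
    rewrite -[e n]scale1r -(rmorph1 (real_complex R)) -(mulVf sn) rmorphM /= -scalerA -eig.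
    by rewrite dotZl (Qadj n).2 (Qe n i)// dot0r mulr0.
  move=> i j; rewrite !ltnS leq_eqVlt => /predU1P[->|im]; rewrite leq_eqVlt => /predU1P[->|jm].
  - rewrite eqxx /= (dotxx hdot) ne e0.
    by case: (0 < s n); rewrite ?expr1n ?expr0n ?(rmorph1 (real_complex R)) ?(rmorph0 (real_complex R)).
  - by rewrite orth// gtn_eqF.
  - by rewrite dotC orth// conjc0 ltn_eqF.
  - exact: IH.
have Qei n i : (i < n)%N -> Q n (e i) = 0 by apply: Qe => j k _ _; exact: oe.
have Qen n : Q n (e n) = e n.
  rewrite /Q /proj big_nat big1 ?subr0// => i /andP[_ im].
  by rewrite oe gtn_eqF//= scale0r.
(* Strong induction removes Q n from [eig]: for i < n, <T' T e_n, e_i> = <e_n, T' T e_i> = s_i^2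
   <e_n, e_i> = 0. *)
have TTe n : T' (T (e n)) = (s n ^+ 2)%:C *: e n.
  have [k] := ubnP n; elim: k n => // k IH n; rewrite ltnS => nk.
  rewrite -eig Qen /Q /proj big_nat big1 ?subr0// => i /andP[_ im].
  rewrite (is_adj_sym bT aT).2 adjT IH ?(leq_trans im)// dotZrR oe gtn_eqF//= mulr0 scale0r//.
have dTT i j : dot (T (e i)) (T (e j)) = (s j ^+ 2)%:C * ((i == j) && (e i != 0))%:R.
  by rewrite adjT TTe dotZrR oe.
have nT i : nm (T (e i)) = s i.
  apply/eqP; rewrite -(@eqrXn2 _ 2) ?nm_ge0//; apply/eqP/(@complexI R).
  rewrite -(dotxx hdot) dTT eqxx e0 /=; have := s0 i; rewrite le_eqVlt => /predU1P[<-|->].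
    by rewrite expr0n /= mul0r.
  by rewrite mulr1.
(* Otherwise infinitely many T e_k would be orthogonal with norm at least r, hence at mutual
   distance at least r, while two of them lie within r / 2 of a cluster point. *)
have scvg : s @ \oo --> (0 : R).
  apply: contrapT => ns.
  have [r [r0 hr]] : exists r, 0 < r /\ forall N, exists n, (N <= n)%N /\ r <= s n.
    apply: contrapT => nex; apply: ns; apply/cvgr0Pnorm_lt => r r0.
    apply: contrapT => nr; apply: nex; exists r; split=> // N.
    apply: contrapT => nN; apply: nr; exists N => // n /= Nn.
    rewrite ger0_norm// ltNge; apply/negP => rs; apply: nN; by exists n.
  have [k hk] : {k : nat -> nat & forall n, (n <= k n)%N /\ r <= s (k n)}.
    by apply: (@choice _ _ (fun n m => (n <= m)%N /\ r <= s m)).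
  have [n|y hy] := cT (fun n => e (k n)); first exact: (ons_le1 hdot oe).
  have r2 : 0 < r / 2 by rewrite divr_gt0.
  have [a [_ ha]] := hy _ r2 0%N; have [b [kab hb]] := hy _ r2 (k a).+1.
  have kk : k a != k b by rewrite neq_ltn (leq_trans kab (hk b).1).
  have : nm (T (e (k a)) - T (e (k b))) < r.
    by rewrite (le_lt_trans (nm_tri y _ _))// (nmB y); lra.
  apply/negP; rewrite -leNgt -ler_sqr ?nnegrE ?nm_ge0 ?(ltW r0)//.
  have d0 : dot (T (e (k a))) (T (e (k b))) = 0 by rewrite dTT (negbTE kk) mulr0.
  rewrite (nm_sqD hdot) dotNr d0 oppr0 mulr0 addr0 nmN !nT.
  rewrite (@le_trans _ _ (s (k a) ^+ 2))// ?lerDl ?sqr_ge0// ler_sqr ?nnegrE ?(ltW r0)//.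
  exact: (hk a).2.
pose f n := ((s n)^-1)%:C *: T (e n).
have sf n : (s n)%:C *: f n = T (e n).
  rewrite /f scalerA -rmorphM /=; have := s0 n; rewrite le_eqVlt => /predU1P[sn|sn].
    have /eqP -> : e n == 0 by rewrite -[_ == _]negbK e0 -sn ltxx.
    by rewrite (linop0 lT) scaler0.
  by rewrite mulfV ?gt_eqF// scale1r.
have f0 n : (f n != 0) = (0 < s n).
  rewrite /f scaler_eq0 negb_or -[T _ == 0]nm_eq0 nT.
  rewrite -(rmorph0 (real_complex R)) (inj_eq (@complexI R)) invr_eq0 andbb.
  by rewrite lt_def s0 andbT.
exists s, e, f; split=> //.
- move=> i j; rewrite dotZl dotZrR dTT f0 e0.
  have [<-|] := eqVneq i j; last by rewrite !mulr0.
  have := s0 i; rewrite le_eqVlt => /predU1P[<-|si]; first by rewrite ltxx !mulr0.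
  rewrite si mulr1 -!rmorphM /= expr2 mulKf ?gt_eqF// mulVf ?gt_eqF//.
(* The remainder of the expansion is T (Q n x), and s n is the norm of T Q n. *)
- move=> x; apply: (tends_squeeze (a := fun n => s n * nm x)).
    move=> n; rewrite nmB.
    rewrite (_ : T x - _ = T (Q n x))//.
    rewrite (linopB lT) (linop_sum lT); congr (_ - _); apply: eq_bigr => k _.
    by rewrite (linopZ lT) mulrC -scalerA sf.
  by rewrite -[X in _ --> X](mul0r (nm x)); apply: cvgMl.
Qed.

End SVD.

(** * Modulus, polar factor and powers in terms of singular values *)

Section Functions.
Variables (R : realType) (H : completeNormedModType R[i]).
Variable dot : {dot H for Num.conj}.
Hypothesis hdot : hilbert_dot dot.
Local Notation C := R[i].
Implicit Types (x y z : H) (T S P Q U : H -> H) (s c : nat -> R) (e f : nat -> H).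

Lemma eq0_scale (e0 : H) : (e0 != 0)%:R *: e0 = e0 :> H.
Proof. by case: eqVneq => [->|_]; rewrite ?scaler0 ?scale1r. Qed.

Lemma diag_on_vec_eq K c a b i : ons dot a -> diag dot K c a b ->
  (a i != 0) = (b i != 0) -> K (a i) = (c i)%:C *: b i.
Proof. by move=> oa hK ab; rewrite (diag_on_vec _ oa hK) ab -scalerA eq0_scale. Qed.

(** Polarization: <S z, z> is real at z = x + y and at z = x + i y. *)
Lemma positive_selfadj S : positive_op dot S -> forall x y, dot (S x) y = dot x (S y).
Proof.
move=> [[lS _] pS] x y.
have im z : complex.Im (dot (S z) z) = 0 by exact: ger0_Im (pS z).
have E1 : complex.Im (dot (S x) y) + complex.Im (dot (S y) x) = 0.
  have := im (x + y); rewrite (linopD lS) dotDl !dotDr.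
  move: (im x) (im y); case: (dot (S x) x) => ? ?; case: (dot (S y) y) => ? ?.
  by case: (dot (S x) y) => ? ?; case: (dot (S y) x) => ? ? /= -> ->; rewrite add0r addr0.
have E2 : complex.Re (dot (S y) x) - complex.Re (dot (S x) y) = 0.
  have := im (x + ('i)%C *: y); rewrite (linopD lS) (linopZ lS) dotDl !dotDr !dotZl !dotZr.
  move: (im x) (im y); case: (dot (S x) x) => ? ?; case: (dot (S y) y) => ? ?.
  by case: (dot (S x) y) => ? ?; case: (dot (S y) x) => ? ? /= -> ->; lra.
rewrite [RHS]dotC; move: E1 E2; case: (dot (S x) y) => a b; case: (dot (S y) x) => a' b' /= E1 E2.
have -> : a' = a by lra.
have -> : b' = - b by lra.
by rewrite -[RHS]/(a +i* - - b) opprK.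
Qed.

Section Given.
Variables (T T' : H -> H) (s : nat -> R) (e f : nat -> H).
Hypotheses (bT : bounded_op T) (aT : is_adj dot T T') (hT : svd dot T s e f).

Let s0 := svd_ge0 hT.
Let oe := svd_onsl hT.
Let of_ := svd_onsr hT.

Lemma svd_ef0 k : (e k != 0) = (f k != 0).
Proof. by rewrite (svd_e0 hT) (svd_f0 hT). Qed.

Lemma svd_eq0 k : s k = 0 -> e k = 0 /\ f k = 0.
Proof.
move=> sk; split; apply/eqP; rewrite -[_ == _]negbK; [rewrite (svd_e0 hT)|rewrite (svd_f0 hT)];
  by rewrite sk ltxx.
Qed.

Lemma svd_T k : T (e k) = (s k)%:C *: f k.
Proof. exact: (diag_on_vec_eq oe (svd_diag hT) (svd_ef0 k)). Qed.

Lemma svd_le (c : R) : 0 <= c -> (forall x, nm (T x) <= c * nm x) -> forall k, s k <= c.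
Proof.
move=> c0 Tc k; have [sk|sk] := eqVneq (s k) 0; first by rewrite sk.
have sk0 : 0 < s k by rewrite lt_def sk s0.
have := Tc (e k); rewrite svd_T nmZ nmR (ons_nm1 hdot of_) (ons_nm1 hdot oe).
by rewrite (svd_e0 hT) (svd_f0 hT) sk0 !mulr1 ger0_norm.
Qed.

Lemma svd_Tbound : exists2 L, 0 <= L & forall k, s k <= L.
Proof. by have [c c0 Tc] := bop_bound bT; exists c => //; exact: svd_le. Qed.

Lemma svd_adj : diag dot T' s f e.
Proof.
have [L L0 sL] := svd_Tbound.
have [|K hK] := @diag_exists _ _ _ hdot s f e L of_ oe L0.
  by move=> k; rewrite ger0_norm.
rewrite (_ : T' = K)//; apply/funext => y; apply: (dot_eqP hdot) => x.
by rewrite -aT.2 (diag_adj hdot (svd_diag hT) hK).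
Qed.

Lemma svd_TT k : T' (T (e k)) = ((s k ^+ 2)%:C) *: e k.
Proof.
have [bT' _] := aT; have [lT' _] := bT'.
rewrite svd_T (linopZ lT') (diag_on_vec_eq of_ svd_adj) ?svd_ef0//.
by rewrite scalerA -rmorphM.
Qed.

Lemma svd_T0 x : (forall i, dot x (e i) = 0) <-> T x = 0.
Proof.
split=> [|Tx i]; first exact: diag_zero (svd_diag hT).
have := s0 i; rewrite le_eqVlt => /predU1P[|] si.
  by have [-> _] := svd_eq0 (esym si); rewrite dot0r.
have := dot_diag_vec hdot x i of_ (svd_diag hT).
rewrite Tx dot0l (svd_f0 hT) si mulr1 => /esym/eqP; rewrite mulf_eq0.
by rewrite -(rmorph0 (real_complex R)) (inj_eq (@complexI R)) gt_eqF//= => /eqP.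
Qed.

Lemma diag_ee_comp Q K (g : nat -> R) : bounded_op Q -> diag dot K (fun=> 1) f e ->
  (forall k, Q (e k) = (g k)%:C *: e k) -> diag dot (Q \o K) g f e.
Proof.
move=> bQ hK Qe x; have [lQ _] := bQ.
have := tends_op bQ (hK x); apply: tends_eq => n.
rewrite /diag_sum (linop_sum lQ); apply: eq_bigr => k _.
by rewrite (linopZ lQ) Qe scalerA mul1r mulrC.
Qed.

Lemma diag_bound_exists (c : nat -> R) (a b : nat -> H) : ons dot a -> ons dot b ->
  (exists2 L, 0 <= L & forall k, `|c k| <= L) ->
  exists K, diag dot K c a b /\ bounded_op K.
Proof.
move=> oa ob [L L0 cL]; have [K hK] := diag_exists hdot oa ob L0 cL.
by exists K; split=> //; exact: (diag_bop hdot oa ob L0 cL hK).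
Qed.

Lemma diag_positive P (c : nat -> R) : (forall k, 0 <= c k) -> diag dot P c e e ->
  bounded_op P -> positive_op dot P.
Proof.
move=> c0 hP bP; split=> // x.
have h := tends_dotl hdot x (hP x).
have E n : dot (diag_sum dot c e e n x) x = (\sum_(0 <= k < n) c k * nm (dot x (e k)) ^+ 2)%:C.
  rewrite dot_suml rmorph_sum; apply: eq_bigr => k _.
  by rewrite dotZl (dotC _ (e k)) -mulrA mulJ -rmorphM.
have h1 : tends (fun n => (\sum_(0 <= k < n) c k * nm (dot x (e k)) ^+ 2)%:C : C) (dot (P x) x).
  by apply: tends_eq h => n.
have re := tends_Re h1.
have Re0 : 0 <= complex.Re (dot (P x) x).
  apply: (cvgr_to_ge re); apply: nearW => n /=.
  by rewrite sumr_ge0// => k _; rewrite mulr_ge0 ?sqr_ge0.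
rewrite (_ : dot (P x) x = (complex.Re (dot (P x) x))%:C) ?ler0c//.
apply: (tends_unique h1); apply/tendsP => r r0.
have /cvgrPdist_lt/(_ _ r0)[N _ HN] := re.
by exists N => n /HN /=; rewrite -rmorphB nmR distrC.
Qed.

(** Uniqueness of the root: if S is positive with S^2 = T' T, then w = S e_k - s_k e_k satisfies S w
    = - s_k w, so positivity gives w = 0 when s_k > 0. On the complement of the e_k, |S x|^2 = <T' T
    x, x> = 0. *)
Lemma abs_opE P : diag dot P s e e -> abs_op dot T = P.
Proof.
move=> hP; have [L L0 sL] := svd_Tbound; have [bT' _] := aT.
have [lT _] := bT; have [lT' _] := bT'.
have sL' k : `|s k| <= L by rewrite ger0_norm.
have bP := diag_bop hdot oe oe L0 sL' hP; have [lP _] := bP.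
have bTT := bop_comp bT' bT.
have Pe k : P (e k) = (s k)%:C *: e k by exact: (diag_on_vec_eq oe hP).
have P0 x : (forall i, dot x (e i) = 0) -> P x = 0 by exact: diag_zero hP.
rewrite /abs_op (adjointE hdot aT) /sqrt_op; case: xgetP => [S _ [pS SS]|/(_ P)[]].
  have [bS pos] := pS; have [lS _] := bS.
  have SSE x : S (S x) = T' (T x) by rewrite -[RHS]/((T' \o T) x) -SS.
  apply: (bop_ext hdot oe bS bP) => [k|x xe].
    rewrite Pe; apply/eqP; rewrite -subr_eq0; apply/eqP.
    set w := S (e k) - _.
    have Sw : S w = - ((s k)%:C *: w).
      rewrite /w (linopB lS) (linopZ lS) SSE svd_TT scalerBr scalerA -rmorphM -expr2.
      by rewrite opprB.
    have := s0 k; rewrite le_eqVlt => /predU1P[|] sk.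
      by have [ek _] := svd_eq0 (esym sk); rewrite /w ek (linop0 lS) scaler0 subrr.
    have := pos w; rewrite Sw dotNl dotZl (dotxx hdot) -rmorphM -rmorphN ler0c oppr_ge0.
    rewrite pmulr_rle0// => h.
    by apply/eqP; rewrite -nm_eq0 -sqrf_eq0 eq_le h sqr_ge0.
  rewrite P0//; apply: (dotxx_eq0 hdot).
  by rewrite -(positive_selfadj pS) SSE (svd_T0 x).1// (linop0 lT') dot0l.
split; first exact: (diag_positive s0 hP bP).
apply: (bop_ext hdot oe (bop_comp bP bP) bTT) => [k|x xe] /=.
  by rewrite Pe (linopZ lP) Pe svd_TT scalerA -rmorphM.
by rewrite (P0 x)// (linop0 lP) (svd_T0 x).1// (linop0 lT').
Qed.

Lemma polar_opE U : diag dot U (fun=> 1) e f -> polar_op dot T = U.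
Proof.
move=> hU.
have l1 (k : nat) : `|1 : R| <= 1 by rewrite normr1.
have bU := diag_bop hdot oe of_ ler01 l1 hU; have [lU _] := bU.
have [P [hP bP]] : exists P, diag dot P s e e /\ bounded_op P.
  apply: diag_bound_exists => //; have [L L0 sL] := svd_Tbound.
  by exists L => // k; rewrite ger0_norm.
have Ue k : U (e k) = f k by rewrite (diag_on_vec_eq oe hU) ?scale1r// svd_ef0.
have Pe k : P (e k) = (s k)%:C *: e k by exact: (diag_on_vec_eq oe hP).
have U0 x : (forall i, dot x (e i) = 0) <-> U x = 0.
  split=> [|Ux i]; first exact: diag_zero hU.
  have := dot_diag_vec hdot x i of_ hU.
  by rewrite Ux dot0l -svd_ef0 mul1r dot_ons_zero.
rewrite /polar_op (abs_opE hP); case: xgetP => [V _ [[bV _] NV TV]|/(_ U)[]].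
  have [lV _] := bV.
  apply: (bop_ext hdot oe bV bU) => [k|x xe].
    rewrite Ue; have := s0 k; rewrite le_eqVlt => /predU1P[|] sk.
      by have [-> ->] := svd_eq0 (esym sk); rewrite (linop0 lV).
    have := svd_T k; rewrite {1}TV /= Pe (linopZ lV) => /(congr1 (fun x => ((s k)^-1)%:C *: x)).
    by rewrite !scalerA -!rmorphM mulVf ?gt_eqF//= !scale1r.
  rewrite (U0 x).1//; have : nullspace T x by exact: (svd_T0 x).1.
  by rewrite -NV.
split.
(* A vector orthogonal to the kernel equals its projection onto the closed span of e, and U
   preserves the norms of the partial sums. *)
- split=> // x xU; have [Q /(_ x)[Qx Qx0]] := diag_proj_exists hdot oe.
  have xQ : x = Q x.
    have nU : nullspace U (x - Q x) by exact: (U0 _).1.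
    apply/eqP; rewrite -subr_eq0; apply/eqP/(dotxx_eq0 hdot).
    rewrite dotBl xU// sub0r; apply/eqP; rewrite oppr_eq0; apply/eqP.
    apply: (tends_unique (tends_dotl hdot _ Qx)); apply: tends_eq (tends_cst _) => n.
    by rewrite dot_suml big1// => k _; rewrite dotZl (dotC _ (e k)) Qx0 conjc0 mulr0.
  have nU : (fun n => nm (diag_sum dot (fun=> 1) e f n x)) @ \oo --> nm x.
    rewrite {2}xQ; have := tends_nm Qx; apply: cvg_trans; apply: near_eq_cvg.
    apply: nearW => n; apply/eqP; rewrite -(@eqrXn2 _ 2) ?nm_ge0//; apply/eqP.
    rewrite (nm_ons_sum hdot oe) (nm_ons_sum hdot of_); apply: eq_bigr => k _.
    by rewrite mul1r svd_ef0.
  by rewrite !nmE; congr (_%:C); exact: (cvg_unique _ (tends_nm (hU x)) nU).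
- apply/seteqP; split=> x; rewrite /nullspace /= => hx.
    by apply: (svd_T0 x).1; apply/U0.
  by apply: (U0 x).1; apply/svd_T0.
- apply: (bop_ext hdot oe bT (bop_comp bU bP)) => [k|x xe] /=.
    by rewrite Pe (linopZ lU) Ue svd_T.
  by rewrite (svd_T0 x).1// (diag_zero hP xe) (linop0 lU).
Qed.

Lemma pow_opE r P Q : 0 < r -> diag dot P s e e -> diag dot Q (fun k => s k `^ r) e e ->
  pow_op P r = Q.
Proof.
move=> r0 hP hQ; have [L L0 sL] := svd_Tbound.
have sL' k : `|s k `^ r| <= L `^ r.
  by rewrite ger0_norm ?powR_ge0// ge0_ler_powR ?nnegrE// ltW.
have bQ := diag_bop hdot oe oe (powR_ge0 L r) sL' hQ; have [lQ _] := bQ.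
have Pe k : P (e k) = (s k)%:C *: e k by exact: (diag_on_vec_eq oe hP).
have Qe k : Q (e k) = (s k `^ r)%:C *: e k by exact: (diag_on_vec_eq oe hQ).
have P0 x : (forall i, dot x (e i) = 0) -> P x = 0 by exact: diag_zero hP.
rewrite /pow_op; case: xgetP => [Q' _ [bQ' hQ']|/(_ Q)[]].
  apply: (bop_ext hdot oe bQ' bQ) => [k|x xe]; first by rewrite Qe; exact: hQ'.
  rewrite (diag_zero hQ xe) (hQ' 0 x) ?powR0 ?gt_eqF ?scale0r//.
  by rewrite P0// scale0r.
split=> // l x Px.
(* An eigenvector for l has a component along e k only where s k = l. *)
have coef k : (s k `^ r)%:C * dot x (e k) = (l `^ r)%:C * dot x (e k).
  have [->|xk] := eqVneq (dot x (e k)) 0; first by rewrite !mulr0.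
  have := dot_diag_vec hdot x k oe hP; rewrite Px dotZl -mulrA dot_ons_zero.
  by move=> /(mulIf xk)/(@complexI R) ->.
have [l0|l0] := eqVneq l 0.
  rewrite l0 powR0 ?gt_eqF// scale0r; apply: (diag_zero hQ) => k.
  have [sk|sk] := eqVneq (s k) 0; first by have [-> _] := svd_eq0 sk; rewrite dot0r.
  have := coef k; rewrite l0 powR0 ?gt_eqF// mul0r => /eqP; rewrite mulf_eq0.
  rewrite -(rmorph0 (real_complex R)) (inj_eq (@complexI R)) powR_eq0 (negbTE sk)/=.
  by move=> /eqP.
(* The factor l turns x into P x, whose expansion in e is available. *)
have E : l%:C *: Q x = l%:C *: ((l `^ r)%:C *: x).
  rewrite scalerA mulrC -scalerA -Px.
  apply: (tends_unique (tendsZ l%:C (hQ x))).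
  have := tendsZ (l `^ r)%:C (hP x); apply: tends_eq => n.
  rewrite /diag_sum !scaler_sumr; apply: eq_bigr => k _; rewrite !scalerA coef.
  have := dot_diag_vec hdot x k oe hP; rewrite Px dotZl -mulrA dot_ons_zero => <-.
  congr (_ *: _); ring.
have := congr1 (fun y => (l^-1)%:C *: y) E.
by rewrite !scalerA -!rmorphM mulVf//= !scale1r mul1r.
Qed.

(** The four chosen operators of the stationarity equation (modulus, power, polar factor, adjoint)
    collapse into one diagonal operator. *)
Lemma gradientE p : 1 < p -> exists S, [/\ bounded_op S,
  diag dot S (fun k => s k `^ (p - 1)) f e &
  pow_op (abs_op dot T) (p - 1) \o adjoint dot (polar_op dot T) = S].
Proof.
move=> p1; have [L L0 sL] := svd_Tbound.
have r0 : 0 < p - 1 by rewrite subr_gt0.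
have sL1 : exists2 L, 0 <= L & forall k, `|s k| <= L by exists L => // k; rewrite ger0_norm.
have sL2 : exists2 L, 0 <= L & forall k, `|s k `^ (p - 1)| <= L.
  exists (L `^ (p - 1)); first exact: powR_ge0.
  by move=> k; rewrite ger0_norm ?powR_ge0// ge0_ler_powR ?nnegrE// ltW.
have sL3 : exists2 L, 0 <= L & forall k : nat, `|1 : R| <= L by exists 1 => // k; rewrite normr1.
have [P [hP bP]] := diag_bound_exists oe oe sL1.
have [Q [hQ bQ]] := diag_bound_exists oe oe sL2.
have [U [hU bU]] := diag_bound_exists oe of_ sL3.
have [U' [hU' bU']] := diag_bound_exists of_ oe sL3.
have aU : is_adj dot U U' by split=> //; exact: diag_adj.
exists (Q \o U'); split; first exact: bop_comp.
  apply: (diag_ee_comp bQ hU') => k; exact: (diag_on_vec_eq oe hQ).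
by rewrite (abs_opE hP) (pow_opE r0 hP hQ) (polar_opE hU) (adjointE hdot aU).
Qed.

End Given.
End Functions.

(** * Schatten sums *)

Section Schatten.
Variables (R : realType) (H : completeNormedModType R[i]).
Variable dot : {dot H for Num.conj}.
Hypothesis hdot : hilbert_dot dot.
Local Notation C := R[i].
Variables (T T' : H -> H) (s : nat -> R) (e f : nat -> H).
Hypotheses (bT : bounded_op T) (aT : is_adj dot T T') (hT : svd dot T s e f).

Let s0 := svd_ge0 hT.
Let oe := svd_onsl hT.

Section Multiplicity.
Variable l : R.
Hypothesis l0 : 0 < l.

Lemma svd_level_finite : exists N, forall k, (N <= k)%N -> s k < l.
Proof.
have /cvgr0Pnorm_lt/(_ _ l0)[N _ HN] := svd_cvg hT.
by exists N => k /HN /=; rewrite ger0_norm.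
Qed.

Variable N : nat.
Hypothesis sN : forall k, (N <= k)%N -> s k < l.

Let I := [seq k <- iota 0 N | s k == l].

Lemma mem_level k : (k \in I) = (s k == l).
Proof.
rewrite mem_filter mem_iota add0n /=; case: eqP => //= sk.
by rewrite ltnNge; apply/negP => /sN; rewrite sk ltxx.
Qed.

(** Components at other levels vanish, and l > 0 places x in the range of |T|, so nothing is left
    outside the span of the e_k. *)
Lemma eigenspace_expansion x : abs_op dot T x = l%:C *: x ->
  x = \sum_(k <- I) dot x (e k) *: e k.
Proof.
have [L L0 sL] := svd_Tbound hdot bT hT.
have [|P [hP bP]] := @diag_bound_exists _ _ _ hdot s e e oe oe.
  by exists L => // k; rewrite ger0_norm.
rewrite (abs_opE hdot bT aT hT hP) => Px.
have coef k : s k != l -> dot x (e k) = 0.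
  move=> sk; have := dot_diag_vec hdot x k oe hP.
  rewrite Px dotZl -mulrA dot_ons_zero => /eqP; rewrite -subr_eq0 -mulrBl mulf_eq0.
  by rewrite subr_eq0 (inj_eq (@complexI R)) eq_sym (negbTE sk) => /eqP.
have lx : l%:C *: x = l%:C *: \sum_(k <- I) dot x (e k) *: e k.
  rewrite -Px; apply: (tends_unique (hP x)); apply/tendsP => r r0; exists N => n Nn.
  rewrite (_ : diag_sum _ _ _ _ _ _ = l%:C *: \sum_(k <- I) dot x (e k) *: e k) ?subrr ?nm0//.
  rewrite big_filter big_mkcond scaler_sumr /diag_sum (@big_cat_nat _ _ _ N)//=.
  rewrite [X in _ + X]big_nat [X in _ + X]big1 ?addr0; last first.
    move=> k /andP[Nk _]; rewrite coef ?mulr0 ?scale0r// lt_eqF//.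
    exact: sN.
  rewrite /index_iota subn0; apply: eq_bigr => k _.
  by have [->|sk] := eqVneq (s k) l; rewrite ?scalerA// coef// mulr0 scale0r scaler0.
have := congr1 (fun y => (l^-1)%:C *: y) lx.
by rewrite !scalerA -!rmorphM mulVf ?gt_eqF//= !scale1r.
Qed.

Lemma multiplicity_svd : multiplicity (abs_op dot T) l = (size I)%:R%:E.
Proof.
have [L L0 sL] := svd_Tbound hdot bT hT.
have [|P [hP bP]] := @diag_bound_exists _ _ _ hdot s e e oe oe.
  by exists L => // k; rewrite ger0_norm.
have PE := abs_opE hdot bT aT hT hP.
apply/eqP; rewrite eq_le; apply/andP; split.
  apply: ge_ereal_sup => _ [n [v [Ev indep]] <-]; rewrite lee_fin ler_nat leqNgt.
  apply/negP => In.
  (* With more rows than columns, the coordinate matrix has a nonzero left kernel vector, which is a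
     linear relation between the v i. *)
  pose M : 'M[C]_(n, size I) := \matrix_(i, j) dot (v i) (e (nth 0%N I j)).
  have : ~~ row_free M.
    rewrite /row_free neq_ltn; apply/orP; left.
    exact: leq_ltn_trans (rank_leq_col M) In.
  rewrite -kermx_eq0 => /rowV0Pn[c /sub_kermxP cM c0].
  have /indep ci : \sum_(i < n) c 0 i *: v i = 0.
    under eq_bigr => i _ do rewrite (eigenspace_expansion (Ev i)) scaler_sumr.
    rewrite exchange_big /= (big_nth 0%N) big_mkord big1// => j _.
    have := congr1 (fun A : 'rV_(size I) => A 0 j) cM; rewrite !mxE => h.
    under eq_bigr do rewrite scalerA.
    rewrite -scaler_suml (_ : \sum_i _ = 0) ?scale0r// -[RHS]h.
    by apply: eq_bigr => i _; rewrite mxE.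
  by move/negP: c0; apply; apply/eqP/rowP => i; rewrite ci mxE.
apply: ereal_sup_ubound; exists (size I) => //.
have inI (i : 'I_(size I)) : s (nth 0%N I i) = l.
  by apply/eqP; rewrite -mem_level mem_nth.
exists (fun i => e (nth 0%N I i)); split=> [i|c c0 j].
  by rewrite /= PE (diag_on_vec_eq oe hP)// inI.
have := congr1 (fun y => dot y (e (nth 0%N I j))) c0.
rewrite dot0l dot_suml (bigD1 j)//= dotZl oe eqxx (svd_e0 hT) inI l0 mulr1.
rewrite big1 ?addr0// => i ij; rewrite dotZl oe nth_uniq ?filter_uniq ?iota_uniq//.
by rewrite (_ : (nat_of_ord i == j) = false) ?mulr0//; apply/negbTE.
Qed.

Lemma multiplicity_weight p : (multiplicity (abs_op dot T) l * (l `^ p)%:E)%E =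
  (\esum_(k in [set k | s k = l]) (s k `^ p)%:E)%E.
Proof.
have -> : [set k | s k = l] = [set` I].
  by apply/seteqP; split=> k /=; rewrite mem_level => /eqP.
rewrite esum_fset; [|exact: finite_seq|by move=> k _; rewrite lee_fin powR_ge0].
rewrite -fsbig_seq ?filter_uniq ?iota_uniq//.
rewrite multiplicity_svd -EFinM (eq_big_seq (fun=> (l `^ p)%:E)).
  by rewrite sumEFin big_const_seq count_predT iter_addr_0 mulr_natl.
by move=> k; rewrite mem_level => /eqP ->.
Qed.

End Multiplicity.

Lemma schatten_sumE p : 0 < p -> schatten_sum dot p T = (\sum_(0 <= k <oo) (s k `^ p)%:E)%E.
Proof.
move=> p0; have ge0 k : (0 <= (s k `^ p)%:E)%E by rewrite lee_fin powR_ge0.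
rewrite nneseries_esumT// /schatten_sum.
under eq_esum => l l0.
  have [N sN] := svd_level_finite l0.
  rewrite (multiplicity_weight l0 sN p); over.
rewrite esum_esum//.
(* The pairs (l, k) with l > 0 and s k = l form the graph of s over the indices with s k > 0. *)
transitivity (\esum_(k in [set k | (0 < s k)%R]) (s k `^ p)%:E)%E.
  apply: (@reindex_esum _ _ _ _ _ (fun k => (s k, k)) (fun j => (s j.2 `^ p)%:E)) => //.
  split=> [k /= sk|j k _ _ [_ //]|[l k] /= [l0 sk]]; first by split.
  by exists k; rewrite /= sk.
rewrite esum_mkcond; apply: eq_esum => k _; case: ifPn => //.
rewrite notin_setE /= => /negP; rewrite -leNgt => sk.
by rewrite (_ : s k = 0) ?powR0 ?gt_eqF//; apply/eqP; rewrite eq_le sk s0.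
Qed.

Lemma schatten_sum_ge p n : 0 < p ->
  ((\sum_(0 <= k < n) s k `^ p)%:E <= schatten_sum dot p T)%E.
Proof.
move=> p0; rewrite schatten_sumE// -sumEFin.
by apply: nneseries_lim_ge => k _ _; rewrite lee_fin powR_ge0.
Qed.

Lemma schatten_sum_le p L : 0 < p -> (forall n, \sum_(0 <= k < n) s k `^ p <= L) ->
  (schatten_sum dot p T <= L%:E)%E.
Proof.
move=> p0 sL; rewrite schatten_sumE//; apply: lime_le.
  by apply: is_cvg_nneseries => k _ _; rewrite lee_fin powR_ge0.
by apply: nearW => n; rewrite sumEFin lee_fin.
Qed.

End Schatten.

(** * Sums of p-th powers along orthonormal systems and the subgradient inequality *)

Section Key.
Variables (R : realType) (H : completeNormedModType R[i]).
Variable dot : {dot H for Num.conj}.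
Hypothesis hdot : hilbert_dot dot.
Local Notation C := R[i].
Implicit Types (x y z : H) (T K V M : H -> H) (s : nat -> R) (e f a b : nat -> H).

(** Tangent line at u = sum of w_j x_j. A total mass W below 1 leaves the remainder u^p (p - 1) (1 -
    W) >= 0. *)
Lemma powR_jensen p m (w x : nat -> R) : 1 <= p ->
  (forall j, 0 <= w j) -> (forall j, 0 <= x j) -> \sum_(0 <= j < m) w j <= 1 ->
  (\sum_(0 <= j < m) w j * x j) `^ p <= \sum_(0 <= j < m) w j * x j `^ p.
Proof.
move=> p1 w0 x0 w1; set u := \sum_(_ <= _ < _) _ * _; set W := \sum_(_ <= _ < _) _ in w1.
have u0 : 0 <= u by apply: sumr_ge0 => j _; exact: mulr_ge0.
apply: le_trans (_ : \sum_(0 <= j < m) w j * (u `^ p + p * u `^ (p - 1) * (x j - u)) <= _).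
  have E : u `^ (p - 1) * u = u `^ p by rewrite mulrC mulr_powRB1//; lra.
  rewrite (eq_bigr (fun j => (u `^ p - p * u `^ p) * w j + p * u `^ (p - 1) * (w j * x j))); last first.
    by move=> j _; rewrite -E; ring.
  rewrite big_split /= -!mulr_sumr -/W -/u -mulrA E -subr_ge0.
  rewrite (_ : _ - _ = u `^ p * (p - 1) * (1 - W)); last by ring.
  by rewrite !mulr_ge0 ?powR_ge0 ?subr_ge0.
by apply: ler_sum => j _; rewrite ler_wpM2l// powR_tangent.
Qed.

Lemma cvg_powR p (u : nat -> R) (l : R) : 0 < p -> (forall n, 0 <= u n) -> u @ \oo --> l ->
  (fun n => u n `^ p) @ \oo --> l `^ p.
Proof.
move=> p0 u0 ul; have l0 : 0 <= l by apply: (cvgr_to_ge ul); exact: nearW.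
apply/cvgrPdist_lt => r r0; have [d d0 Hd] := powR_cont p0 l0 r0.
have /cvgrPdist_lt/(_ _ d0)[N _ HN] := ul.
by exists N => // n /HN /=; rewrite distrC => h; rewrite distrC Hd.
Qed.

Lemma cvg_sum_nat n (u : nat -> nat -> R) (l : nat -> R) :
  (forall k, (fun m => u k m) @ \oo --> l k) ->
  (fun m => \sum_(0 <= k < n) u k m) @ \oo --> \sum_(0 <= k < n) l k.
Proof.
move=> ul; elim: n => [|n IH].
  by rewrite big_geq//; under eq_fun do rewrite big_geq//; exact: cvg_cst.
by rewrite big_nat_recr//=; under eq_fun do rewrite big_nat_recr//=; exact: cvgD.
Qed.

(** Contractive images of orthonormal systems qualify. The norm bound controls the row sums below,
    the Bessel inequality the column sums. *)
Definition bessel1 (x : nat -> H) := (forall k, nm (x k) <= 1) /\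
  forall h n, \sum_(0 <= k < n) nm (dot h (x k)) ^+ 2 <= nm h ^+ 2.

Lemma ons_bessel1 e : ons dot e -> bessel1 e.
Proof. by move=> oe; split=> [k|h n]; [exact: (ons_le1 hdot oe)|exact: Bessel]. Qed.

Lemma nm_dotC x y : nm (dot x y) = nm (dot y x).
Proof. by rewrite dotC; exact: nmJ. Qed.

Lemma bessel1_op e M M' c : ons dot e -> is_adj dot M M' -> 0 < c ->
  (forall x, nm (M x) <= c * nm x) -> bessel1 (fun k => (c^-1)%:C *: M (e k)).
Proof.
move=> oe [_ aM] c0 Mc; have ci : 0 <= c^-1 by rewrite invr_ge0 ltW.
split=> [k|h n].
  rewrite nmZ nmR ger0_norm// mulrC ler_pdivrMr// mul1r (le_trans (Mc _))//.
  by rewrite ler_piMr ?(ltW c0)// (ons_le1 hdot oe).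
have M'c := is_adj_bound hdot (ltW c0) Mc aM.
apply: le_trans (_ : c ^- 2 * (c * nm h) ^+ 2 <= _); last first.
  by rewrite exprMn mulKf// expf_neq0 ?gt_eqF.
apply: le_trans (_ : c ^- 2 * nm (M' h) ^+ 2 <= _); last first.
  by rewrite ler_wpM2l ?invr_ge0 ?sqr_ge0// ler_sqr ?nnegrE ?mulr_ge0 ?nm_ge0 ?(ltW c0).
apply: le_trans (_ : c ^- 2 * \sum_(0 <= k < n) nm (dot (M' h) (e k)) ^+ 2 <= _); last first.
  by rewrite ler_wpM2l ?invr_ge0 ?sqr_ge0// (Bessel hdot oe).
rewrite mulr_sumr; apply: ler_sum => k _.
rewrite dotZrR nmM nmR ger0_norm// exprMn exprVn (nm_dotC h) aM (nm_dotC (e k)).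
exact: lexx.
Qed.

(* The weights |<x_k, e_j> <f_j, y_k>| form a doubly substochastic matrix. *)
Lemma diag_schatten_fin p s e f (x y : nat -> H) n m : 1 <= p -> (forall j, 0 <= s j) ->
  ons dot e -> ons dot f -> bessel1 x -> bessel1 y ->
  \sum_(0 <= k < n) nm (dot (diag_sum dot s e f m (x k)) (y k)) `^ p <=
  \sum_(0 <= j < m) s j `^ p.
Proof.
move=> p1 s0 oe of_ [x1 bx] [y1 by_].
pose w k j := nm (dot (x k) (e j)) * nm (dot (f j) (y k)).
have w0 k j : 0 <= w k j by rewrite mulr_ge0 ?nm_ge0.
(* This turns every row and column sum into the mean of two Bessel sums. *)
have wle k j : w k j <= (nm (dot (x k) (e j)) ^+ 2 + nm (dot (f j) (y k)) ^+ 2) / 2.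
  by have := sqr_ge0 (nm (dot (x k) (e j)) - nm (dot (f j) (y k))); rewrite sqrrB /w; lra.
have rows k : \sum_(0 <= j < m) w k j <= 1.
  apply: le_trans (ler_sum _ (fun j _ => wle k j)) _; rewrite -mulr_suml big_split /=.
  have h1 := Bessel hdot oe (x k) m; have h2 := Bessel hdot of_ (y k) m.
  under [X in (_ + X) / _]eq_bigr do rewrite nm_dotC.
  have : nm (x k) ^+ 2 <= 1 by rewrite expr_le1 ?nm_ge0.
  have : nm (y k) ^+ 2 <= 1 by rewrite expr_le1 ?nm_ge0.
  lra.
have cols j : \sum_(0 <= k < n) w k j <= 1.
  apply: le_trans (ler_sum _ (fun k _ => wle k j)) _; rewrite -mulr_suml big_split /=.
  have h1 := bx (e j) n; have h2 := by_ (f j) n.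
  under [X in (X + _) / _]eq_bigr do rewrite nm_dotC.
  have : nm (e j) ^+ 2 <= 1 by rewrite expr_le1 ?nm_ge0// (ons_le1 hdot oe).
  have : nm (f j) ^+ 2 <= 1 by rewrite expr_le1 ?nm_ge0// (ons_le1 hdot of_).
  lra.
apply: le_trans (_ : \sum_(0 <= k < n) \sum_(0 <= j < m) w k j * s j `^ p <= _).
  apply: ler_sum => k _; apply: le_trans (powR_jensen p1 (w0 k) s0 (rows k)).
  rewrite ge0_ler_powR ?nnegrE ?nm_ge0 ?sumr_ge0//; [lra| |].
    by move=> j _; rewrite mulr_ge0.
  rewrite dot_suml (le_trans (nm_sum _ _ _))//; apply: ler_sum => j _.
  by rewrite dotZl !nmM nmR ger0_norm// -mulrA mulrC.
rewrite exchange_big /=; apply: ler_sum => j _.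
by rewrite -mulr_suml ler_piMl ?powR_ge0.
Qed.

Lemma diag_schatten_le p K s e f (x y : nat -> H) n L : 1 <= p -> (forall j, 0 <= s j) ->
  ons dot e -> ons dot f -> diag dot K s e f ->
  (forall m, \sum_(0 <= j < m) s j `^ p <= L) -> bessel1 x -> bessel1 y ->
  \sum_(0 <= k < n) nm (dot (K (x k)) (y k)) `^ p <= L.
Proof.
move=> p1 s0 oe of_ hK sL bx by_.
have h := @cvg_sum_nat n (fun k m => nm (dot (diag_sum dot s e f m (x k)) (y k)) `^ p)
  (fun k => nm (dot (K (x k)) (y k)) `^ p).
apply: (cvgr_to_le (h _)) => [k|].
  apply: cvg_powR; [lra|by move=> ?; exact: nm_ge0|].
  exact: tends_nm (tends_dotl hdot (y k) (hK (x k))).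
apply: nearW => m; apply: le_trans (sL m).
exact: diag_schatten_fin.
Qed.

(** The ideal property of S_p: M is absorbed into the vectors c^-1 M e_k, so only the expansion of V
    enters. *)
Lemma diag_schatten_comp p V v a b M M' c e f n L : 1 <= p -> (forall j, 0 <= v j) ->
  ons dot a -> ons dot b -> diag dot V v a b ->
  (forall m, \sum_(0 <= j < m) v j `^ p <= L) ->
  is_adj dot M M' -> 0 < c -> (forall x, nm (M x) <= c * nm x) ->
  ons dot e -> ons dot f ->
  \sum_(0 <= k < n) nm (dot (V (M (e k))) (f k)) `^ p <= c `^ p * L.
Proof.
move=> p1 v0 oa ob hV vL aM c0 Mc oe of_.
have lV := diag_linear hV.
have := @diag_schatten_le p V v a b _ f n L p1 v0 oa ob hV vL (bessel1_op oe aM c0 Mc) (ons_bessel1 of_).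
move=> /(ler_wpM2l (powR_ge0 c p)); apply: le_trans; rewrite mulr_sumr; apply: ler_sum => k _.
rewrite -powRM ?nm_ge0 ?(ltW c0)// (linopZ lV) dotZl nmM nmR ger0_norm ?invr_ge0 ?(ltW c0)//.
by rewrite mulVKf ?gt_eqF.
Qed.

Section Subgradient.
Variables (p : R) (T : H -> H) (s : nat -> R) (e f : nat -> H).
Hypotheses (p1 : 1 <= p) (hT : svd dot T s e f).

Lemma svd_dot k : dot (T (e k)) (f k) = (s k)%:C.
Proof.
rewrite (svd_T hT) dotZl (svd_onsr hT) eqxx (svd_f0 hT) /=.
by have := svd_ge0 hT k; rewrite le_eqVlt => /predU1P[<-|->]; rewrite ?mul0r// mulr1.
Qed.

(** Stated for partial sums, so that convergence of the trace can be settled separately in each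
    application. *)
Lemma subgradient T1 s1 e1 f1 L n : svd dot T1 s1 e1 f1 ->
  (forall m, \sum_(0 <= k < m) s1 k `^ p <= L) ->
  \sum_(0 <= k < n) s k `^ p +
    p * complex.Re (\sum_(0 <= k < n) (s k `^ (p - 1))%:C * dot (T1 (e k) - T (e k)) (f k)) <= L.
Proof.
move=> hT1 s1L.
have := diag_schatten_le n p1 (svd_ge0 hT1) (svd_onsl hT1) (svd_onsr hT1) (svd_diag hT1) s1L
  (ons_bessel1 (svd_onsl hT)) (ons_bessel1 (svd_onsr hT)).
apply: le_trans; rewrite cRe_sum mulr_sumr -big_split; apply: ler_sum => k _ /=.
rewrite cReMl dotBl svd_dot cReB /= mulrA.
apply: le_trans (powR_tangent p1 (svd_ge0 hT k) (nm_ge0 _)).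
have p0 : 0 <= p := le_trans ler01 p1.
rewrite lerD2l ler_wpM2l ?mulr_ge0 ?powR_ge0//.
by rewrite lerD2r Re_le_nm.
Qed.

End Subgradient.
End Key.

(** * Continuity of the gradient *)

Section Continuity.
Variables (R : realType) (H : completeNormedModType R[i]).
Variable dot : {dot H for Num.conj}.
Hypothesis hdot : hilbert_dot dot.
Local Notation C := R[i].

(** The inequality of [powR_modulus] at x = s_k is summed against |<b, e_k>|^2. It will be applied
    to perturbed operators, with l and b taken from the limit. *)
Lemma gradient_eigen_bound p (T T' G : H -> H) s e f l (c K eps M : R) b :
  svd dot T s e f -> is_adj dot T T' -> bounded_op T ->
  diag dot G (fun k => s k `^ (p - 1)) e f ->
  (forall k, s k <= M) -> 0 <= eps -> 0 <= K ->
  (forall x, 0 <= x <= M ->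
     (x `^ (p - 1) - c * x) ^+ 2 <= eps + K * (x ^+ 2 - l ^+ 2) ^+ 2) ->
  nm (G b - c%:C *: T b) ^+ 2 <=
    eps * nm b ^+ 2 + K * nm (T' (T b) - (l ^+ 2)%:C *: b) ^+ 2.
Proof.
move=> hT aT bT hG sM eps0 K0 mod; set w := T' (T b) - _.
have oe := svd_onsl hT; have of_ := svd_onsr hT.
have wk k : dot w (e k) = ((s k ^+ 2 - l ^+ 2)%:C) * dot b (e k).
  rewrite /w dotBl dotZl (is_adj_sym bT aT).2 (svd_T hT) dotZrR.
  rewrite (dot_diag_vec hdot b k of_ (svd_diag hT)) -(svd_ef0 hT) -mulrA dot_ons_zero.
  by rewrite mulrA -rmorphM -expr2 -mulrBl -rmorphB.
have h : tends (fun n => \sum_(0 <= k < n) ((s k `^ (p - 1) - c * s k)%:C * dot b (e k)) *: f k)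
    (G b - c%:C *: T b).
  have := tendsB (hG b) (tendsZ c%:C (svd_diag hT b)); apply: tends_eq => n.
  rewrite /diag_sum scaler_sumr -sumrB; apply: eq_bigr => k _.
  by rewrite scalerA -scalerBl rmorphB (rmorphM _ c); congr (_ *: _); ring.
have nh := tends_nm h.
have : (fun n => nm (\sum_(0 <= k < n) ((s k `^ (p - 1) - c * s k)%:C * dot b (e k)) *: f k) ^+ 2)
    @ \oo --> nm (G b - c%:C *: T b) ^+ 2 by apply: cvgM.
move=> h2; apply: (cvgr_to_le h2); apply: nearW => n.
apply: le_trans (nm_ons_sum_le hdot of_ _ _ _) _.
apply: le_trans (_ : \sum_(0 <= k < n) (eps * nm (dot b (e k)) ^+ 2 + K * nm (dot w (e k)) ^+ 2) <= _).
  apply: ler_sum => k _; rewrite wk !nmM !nmR !exprMn !real_normK ?num_real//.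
  rewrite [K * _]mulrA -mulrDl ler_wpM2r ?sqr_ge0// mod// (svd_ge0 hT) sM//.
rewrite big_split /= -!mulr_sumr lerD// ler_wpM2l//; exact: (Bessel hdot oe).
Qed.

Variables (p : R) (p1 : 1 < p).
Variables (T T' G : H -> H) (s : nat -> R) (e f : nat -> H).
Hypotheses (bT : bounded_op T) (aT : is_adj dot T T') (hT : svd dot T s e f).
Hypothesis hG : diag dot G (fun k => s k `^ (p - 1)) e f.
Variables (Tn Tn' Gn : nat -> H -> H) (sn : nat -> nat -> R) (en fn : nat -> nat -> H).
Hypotheses (bTn : forall n, bounded_op (Tn n)) (aTn : forall n, is_adj dot (Tn n) (Tn' n)).
Hypothesis hTn : forall n, svd dot (Tn n) (sn n) (en n) (fn n).
Hypothesis hGn : forall n, diag dot (Gn n) (fun k => sn n k `^ (p - 1)) (en n) (fn n).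
Variables (d : nat -> R) (M : R).
Hypotheses (d0 : forall n, 0 <= d n) (dcvg : d @ \oo --> (0 : R)) (M0 : 0 <= M).
Hypothesis Td : forall n x, nm (Tn n x - T x) <= d n * nm x.
Hypothesis TM : forall n x, nm (Tn n x) <= M * nm x.

Lemma tends_Tn x : tends (fun n => Tn n x) (T x).
Proof.
apply: (tends_squeeze (a := fun n => d n * nm x)) => //.
by rewrite -[X in _ --> X](mul0r (nm x)); exact: cvgMl.
Qed.

Lemma tends_TTn x : tends (fun n => Tn' n (Tn n x)) (T' (T x)).
Proof.
have T'M n := is_adj_bound hdot M0 (TM n) (aTn n).2.
have T'd n : forall y, nm (Tn' n y - T' y) <= d n * nm y.
  apply: (is_adj_bound hdot (d0 n) (Td n)) => u v.
  by rewrite dotBl dotBr (aTn n).2 aT.2.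
apply: (tends_squeeze (a := fun n => M * (d n * nm x) + d n * nm (T x))) => [n|].
  have -> : Tn' n (Tn n x) - T' (T x) =
      Tn' n (Tn n x - T x) + (Tn' n (T x) - T' (T x)).
    by have [[lT' _] _] := aTn n; rewrite (linopB lT') addrA subrK.
  rewrite (le_trans (nmD _ _))// lerD//.
  by rewrite (le_trans (T'M _ _))// ler_wpM2l.
have -> : (0 : R) = M * (0 * nm x) + 0 * nm (T x) by rewrite !mul0r mulr0 addr0.
by apply: cvgD; [apply: cvgMr|]; exact: cvgMl.
Qed.

(** Compare G_n b with c T_n b, and the latter with c T b = G b. The premise ranges over c because
    [powR_modulus] supplies it; for l = 0 every c qualifies. *)
Lemma gradient_cvg_eigen (l : R) (b : H) : 0 <= l -> T' (T b) = (l ^+ 2)%:C *: b ->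
  (forall c, l `^ (p - 1) = c * l -> G b = c%:C *: T b) ->
  tends (fun n => Gn n b) (G b).
Proof.
move=> l0 eig Gb; apply/tendsP => r r0.
have nb : 0 < nm b ^+ 2 + 1 by rewrite ltr_wpDl ?sqr_ge0.
(* The square (r / 2)^2 is shared equally between the two terms of [gradient_eigen_bound]. *)
pose eps := (r / 2) ^+ 2 / 2 / (nm b ^+ 2 + 1).
have r4 : 0 < (r / 2) ^+ 2 / 2 by rewrite divr_gt0// exprn_gt0// divr_gt0.
have eps0 : 0 < eps by rewrite divr_gt0.
have [c [K [cl K0 mod]]] := @powR_modulus _ p l M eps p1 l0 eps0.
have w0 : (fun n => K * nm (Tn' n (Tn n b) - (l ^+ 2)%:C *: b) ^+ 2) @ \oo --> (0 : R).
  have := tends_TTn b; rewrite /tends eig => h.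
  have -> : (0 : R) = K * (0 * 0) by rewrite !mulr0.
  by apply: cvgMr; apply: cvgM.
have c0 : (fun n => nm (c%:C : C) * nm (Tn n b - T b)) @ \oo --> (0 : R).
  by rewrite -[X in _ --> X](mulr0 (nm (c%:C : C))); apply: cvgMr; exact: tends_Tn.
have r2 : 0 < r / 2 by rewrite divr_gt0.
have /cvgrPdist_lt/(_ _ r4)[N1 _ H1] := w0.
have /cvgrPdist_lt/(_ _ r2)[N2 _ H2] := c0.
exists (maxn N1 N2) => n; rewrite geq_max => /andP[/H1 /= h1 /H2 /= h2].
rewrite !sub0r !normrN in h1 h2.
have {h1}h1 := le_lt_trans (ler_norm _) h1; have {h2}h2 := le_lt_trans (ler_norm _) h2.
rewrite (Gb c)// (le_lt_trans (nm_tri (c%:C *: Tn n b) _ _))// [ltRHS](splitr r) ltrD//.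
  rewrite -ltr_sqr ?nnegrE ?nm_ge0 ?(ltW r2)//.
  have sM := svd_le hdot (hTn n) M0 (TM n).
  apply: le_lt_trans (gradient_eigen_bound b (hTn n) (aTn n) (bTn n) (hGn n) sM (ltW eps0) K0 mod) _.
  rewrite [ltRHS](splitr _) ler_ltD//.
  rewrite /eps mulrAC ler_pdivrMr// ler_wpM2l ?(ltW r4)// lerDl//.
by rewrite -scalerBr nmZ.
Qed.

(** Convergence on the e k and on the kernel of T extends by density, as the G_n are uniformly
    bounded. *)
Lemma gradient_cvg b : tends (fun n => Gn n b) (G b).
Proof.
have oe := svd_onsl hT; have of_ := svd_onsr hT; have s0 := svd_ge0 hT.
have pp : 0 < p - 1 by rewrite subr_gt0.
have [P hP] := diag_proj_exists hdot oe; have [Pb Pb0] := hP b.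
have [L L0 sL] := svd_Tbound hdot bT hT.
pose K := Num.max L M.
have K0 : 0 <= K `^ (p - 1) by exact: powR_ge0.
have KG x : nm (G x) <= K `^ (p - 1) * nm x.
  apply: (tends_bound _ (hG x)) => n; apply: (nm_diag_sum hdot oe of_ K0) => k.
  rewrite ger0_norm ?powR_ge0// ge0_ler_powR ?nnegrE ?(ltW pp)// le_max ?L0//.
  by rewrite sL.
have KGn n x : nm (Gn n x) <= K `^ (p - 1) * nm x.
  apply: (tends_bound _ (hGn n x)) => m.
  apply: (nm_diag_sum hdot (svd_onsl (hTn n)) (svd_onsr (hTn n)) K0) => k.
  rewrite ger0_norm ?powR_ge0// ge0_ler_powR ?nnegrE ?(ltW pp) ?(svd_ge0 (hTn n))// le_max ?L0//.
  by rewrite (svd_le hdot (hTn n) M0 (TM n)) orbT.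
have lG : linear G by exact: diag_linear hG.
have lGn n : linear (Gn n) by exact: diag_linear (hGn n).
have ve k : tends (fun n => Gn n (e k)) (G (e k)).
  apply: (@gradient_cvg_eigen (s k)) => // [|c sc].
    exact: (svd_TT hdot bT aT hT).
  rewrite (svd_T hT) (diag_on_vec_eq oe hG (svd_ef0 hT k)) sc.
  by rewrite scalerA -rmorphM.
have v0 x : (forall i, dot x (e i) = 0) -> tends (fun n => Gn n x) (G x).
  move=> xe; have Tx : T x = 0 by exact: (diag_zero (svd_diag hT)).
  have [[lT' _] _] := aT.
  apply: (@gradient_cvg_eigen 0) => // [|c _].
    by rewrite Tx (linop0 lT') expr0n scale0r.
  by rewrite Tx scaler0 (diag_zero hG xe).
have vP m : tends (fun n => Gn n (proj dot e m b)) (G (proj dot e m b)).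
  rewrite (linop_sum lG).
  have h k : tends (fun n => Gn n (dot b (e k) *: e k)) (G (dot b (e k) *: e k)).
    rewrite (linopZ lG); apply: tends_eq (tendsZ (dot b (e k)) (ve k)) => n.
    by rewrite (linopZ (lGn n)).
  apply: tends_eq (@tends_sum _ _ _ (index_iota 0 m) xpredT _ _ (fun k _ => h k)) => n.
  by rewrite (linop_sum (lGn n)).
apply/tendsP => r r0.
have r4 : 0 < r / 4 / (K `^ (p - 1) + 1) by rewrite !divr_gt0// ltr_wpDl.
have [m Hm] := proj1 (tendsP _ _) Pb _ r4.
(* A finite combination of the e k plus the kernel component of b. The errors are r / 4 for G_n, r /
   2 at y and r / 4 for G. *)
pose y := proj dot e m b + (b - P b).
have by_ : nm (b - y) < r / 4 / (K `^ (p - 1) + 1).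
  rewrite (_ : b - y = P b - proj dot e m b) ?(nmB (P b)) ?Hm//.
  by rewrite /y opprD opprB [_ + (P b - b)]addrC addrA [b + _]addrC subrK.
have [N HN] := proj1 (tendsP _ _) (tendsD (vP m) (v0 _ Pb0)) _ (divr_gt0 r0 (ltr0n R 2)).
exists N => n /HN; rewrite -(linopD lG) -(linopD (lGn n)) -/y => h.
have h1 : K `^ (p - 1) * nm (b - y) <= r / 4.
  move: by_; rewrite ltr_pdivlMr ?ltr_wpDl// mulrDr mulr1 mulrC.
  by have := nm_ge0 (b - y); lra.
rewrite (_ : _ - _ = Gn n (b - y) + (Gn n y - G y) - G (b - y)); last first.
  by rewrite (linopB lG) (linopB (lGn n)) addrA subrK opprB addrA subrK.
rewrite (le_lt_trans (nmD _ _))// nmN; have := nmD (Gn n (b - y)) (Gn n y - G y).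
by have := KG (b - y); have := KGn n (b - y); lra.
Qed.

End Continuity.

(** * Vanishing of the trace *)

Section Trace.
Variables (R : realType) (H : completeNormedModType R[i]).
Variable dot : {dot H for Num.conj}.
Hypothesis hdot : hilbert_dot dot.
Local Notation C := R[i].

Lemma nneg_series_cvg (u : nat -> R) L : (forall k, 0 <= u k) ->
  (forall n, \sum_(0 <= k < n) u k <= L) ->
  exists l, (fun n => \sum_(0 <= k < n) u k) @ \oo --> l /\
    forall n, \sum_(0 <= k < n) u k <= l.
Proof.
move=> u0 uL; pose S n := \sum_(0 <= k < n) u k.
have Smono : {homo S : n m / (n <= m)%N >-> n <= m}.
  by move=> n m nm; rewrite /S [leRHS](@big_cat_nat _ _ _ n)//= lerDl sumr_ge0.
have cS : cvg (S @ \oo).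
  by apply: nondecreasing_is_cvgn => //; exists L => _ [n _ <-]; exact: uL.
exists (lim (S @ \oo)); split=> // n; exact: nondecreasing_cvgn_le.
Qed.

Lemma nneg_series_tail (u : nat -> R) L : (forall k, 0 <= u k) ->
  (forall n, \sum_(0 <= k < n) u k <= L) ->
  forall r, 0 < r -> exists m, forall n, \sum_(0 <= k < n) u (k + m)%N <= r.
Proof.
move=> u0 uL r r0; have [l [ul ule]] := nneg_series_cvg u0 uL.
have /cvgrPdist_lt/(_ _ r0)[m _ /(_ m (leqnn m))/= Hm] := ul.
exists m => n; have := ule (n + m)%N.
rewrite (@big_cat_nat _ _ _ m)//= ?leq_addl// -{2}[m]add0n big_addn addnK.
by move: Hm; rewrite ltr_norml; lra.
Qed.

Lemma diag_tail (V : H -> H) (v : nat -> R) (a b : nat -> H) m : diag dot V v a b ->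
  diag dot (fun x => V x - diag_sum dot v a b m x)
    (fun k => v (k + m)%N) (fun k => a (k + m)%N) (fun k => b (k + m)%N).
Proof.
move=> hV x; have /tendsP h := tendsB (hV x) (tends_cst (diag_sum dot v a b m x)).
apply/tendsP => r /h[N HN]; exists N => n Nn.
have := HN (n + m)%N (leq_trans Nn (leq_addr _ _)).
have -> : diag_sum dot v a b (n + m) x = diag_sum dot v a b m x +
    diag_sum dot (fun k => v (k + m)%N) (fun k => a (k + m)%N) (fun k => b (k + m)%N) n x.
  rewrite /diag_sum (@big_cat_nat _ _ _ m)//= ?leq_addl//; congr (_ + _).
  by rewrite -{1}[m]add0n big_addn addnK.
by rewrite [diag_sum _ _ _ _ m x + _]addrC addrK.
Qed.

Lemma ons_shift e m : ons dot e -> ons dot (fun k => e (k + m)%N).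
Proof. by move=> oe i j; rewrite oe eqn_add2r. Qed.

Section GradientTrace.
Variables (p : R) (s : nat -> R) (e f : nat -> H).

(** With S f_k = s_k^(p-1) e_k, these are the partial sums of the trace of N S along f. *)
Definition partial_trace (N : H -> H) n :=
  \sum_(0 <= k < n) (s k `^ (p - 1))%:C * dot (N (e k)) (f k).

Lemma partial_traceD N1 N2 n :
  partial_trace (fun x => N1 x + N2 x) n = partial_trace N1 n + partial_trace N2 n.
Proof. by rewrite /partial_trace -big_split; apply: eq_bigr => k _ /=; rewrite dotDl mulrDr. Qed.

Lemma partial_trace_rank1 (G : H -> H) b w : diag dot G (fun k => s k `^ (p - 1)) e f ->
  tends (partial_trace (fun x => dot x b *: w)) (dot w (G b)).
Proof.
move=> hG; have := tends_dotr hdot w (hG b); apply: tends_eq => n.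
rewrite dot_sumr; apply: eq_bigr => k _.
by rewrite -scalerA dotZrR dotZr dotZl (dotC _ (e k)).
Qed.

Variables (T : H -> H) (L : R).
Hypotheses (p1 : 1 < p) (hT : svd dot T s e f).
Hypothesis sL : forall n, \sum_(0 <= k < n) s k `^ p <= L.

Let s0 := svd_ge0 hT.
Let oe := svd_onsl hT.
Let of_ := svd_onsr hT.

(** Choosing r small first, and then N with small K, makes the trace small uniformly in n. *)
Lemma partial_trace_young (N : H -> H) r K n : 0 < r ->
  \sum_(0 <= k < n) nm (dot (N (e k)) (f k)) `^ p <= K ->
  nm (partial_trace N n) <= r * L + (r `^ (p - 1))^-1 * K.
Proof.
move=> r0 NK; have r1 : 0 <= (r `^ (p - 1))^-1 by rewrite invr_ge0 powR_ge0.
apply: le_trans (_ : r * (\sum_(0 <= k < n) s k `^ p) +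
    (r `^ (p - 1))^-1 * (\sum_(0 <= k < n) nm (dot (N (e k)) (f k)) `^ p) <= _).
  rewrite !mulr_sumr -big_split (le_trans (nm_sum _ _ _))//; apply: ler_sum => k _ /=.
  by rewrite nmM nmR ger0_norm ?powR_ge0// powR_young// nm_ge0.
by rewrite lerD// ler_wpM2l// ltW.
Qed.

Variables (S G V V' : H -> H) (v : nat -> R) (a g : nat -> H) (K : R).
Hypotheses (hS : diag dot S (fun k => s k `^ (p - 1)) f e)
           (hG : diag dot G (fun k => s k `^ (p - 1)) e f).
Hypotheses (bV : bounded_op V) (aV : is_adj dot V V') (hV : svd dot V v a g).
Hypothesis vK : forall n, \sum_(0 <= k < n) v k `^ p <= K.
Variables (A A' B B' Y Y' : H -> H).
Hypotheses (bA : bounded_op A) (bB : bounded_op B) (bY : bounded_op Y).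
Hypotheses (aA : is_adj dot A A') (aB : is_adj dot B B') (aY : is_adj dot Y Y').
Variable h : nat -> H.
Hypothesis hh : total_ons dot h.
Hypothesis BSVA : forall x, B (S (V (A x))) = 0.

(** Here the equation B S V A = 0 enters: each rank one term has limit <B S V A Y h_i, h_i>. *)
Lemma partial_trace_finite_rank r :
  tends (partial_trace (fun x => V (A (Y (proj dot h r (B x)))))) 0.
Proof.
have [[lV _] [lA _] [lY _]] := And3 bV bA bY.
have t := @tends_sum _ _ _ (index_iota 0 r) xpredT _ _
  (fun i _ => partial_trace_rank1 (B' (h i)) (V (A (Y (h i)))) hG).
have E : \sum_(0 <= i < r) dot (V (A (Y (h i)))) (G (B' (h i))) = 0.
  rewrite big1// => i _; rewrite -(diag_adj hdot hS hG) -aB.2 BSVA dot0l//.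
rewrite E in t; apply: tends_eq t => n.
rewrite exchange_big; apply: eq_bigr => k _ /=.
rewrite -mulr_sumr -dot_suml; congr (_ * dot _ _).
rewrite /proj (linop_sum lY) (linop_sum lA) (linop_sum lV); apply: eq_bigr => i _.
by rewrite (linopZ lY) (linopZ lA) (linopZ lV) aB.2.
Qed.

(** The limit tests N on finitely many fixed vectors [S (g j)], so it vanishes as N tends strongly
    to 0. *)
Lemma partial_trace_truncation (N : H -> H) m : bounded_op N ->
  tends (partial_trace (fun x => diag_sum dot v a g m (N x)))
    (\sum_(0 <= j < m) (v j)%:C * dot (N (S (g j))) (a j)).
Proof.
move=> bN; have [lN _] := bN.
have := @tends_sum _ _ _ (index_iota 0 m) xpredT _ _
  (fun j _ => tendsMl (v j)%:C (tends_dotl hdot (a j) (tends_op bN (hS (g j))))).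
apply: tends_eq => n.
transitivity (\sum_(0 <= j < m) \sum_(0 <= k < n)
    (s k `^ (p - 1))%:C * ((v j)%:C * dot (N (e k)) (a j) * dot (g j) (f k))).
  apply: eq_bigr => j _; rewrite (linop_sum lN) dot_suml mulr_sumr; apply: eq_bigr => k _.
  by rewrite (linopZ lN) dotZl; ring.
rewrite exchange_big; apply: eq_bigr => k _ /=.
by rewrite -mulr_sumr dot_suml; congr (_ * _); apply: eq_bigr => j _; rewrite dotZl.
Qed.

(* V splits into a truncation, of finite rank, and a tail that is small in the
   p-norm; Y is replaced by Y composed with the projections on the span of the first
   vectors of h.  This works for all p > 1 without factoring S V as a trace class
   operator. *)
Lemma partial_trace_cvg0 : tends (partial_trace (fun x => V (A (Y (B x))))) 0.
Proof.
have [[lV _] [lA _] [lY _] [lB _]] := And4 bV bA bY bB.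
have [cA cA0 HA] := bop_bound1 bA; have [cY cY0 HY] := bop_bound1 bY.
have [cB cB0 HB] := bop_bound1 bB.
have [oh th] := hh.
pose Q r x := x - proj dot h r x.
have bQ r : bounded_op (Q r) by apply: bop_sub; [exact: bop_id|exact: bop_fin_proj].
have aQ r : is_adj dot (Q r) (Q r).
  by split=> // x y; rewrite /Q dotBl dotBr dot_proj_sym.
pose N r x := A (Y (Q r (B x))).
have bN r : bounded_op (N r) by exact: (bop_comp bA (bop_comp bY (bop_comp (bQ r) bB))).
have aN r := is_adj_comp aA (is_adj_comp aY (is_adj_comp (aQ r) aB)).
pose c := cA * (cY * cB).
have c0 : 0 < c by rewrite !mulr_gt0.
(* The bound is uniform in r because Q r is a contraction; hence m can be fixed before r. *)
have Nc r x : nm (N r x) <= c * nm x.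
  rewrite /c -!mulrA (le_trans (HA _))// ler_wpM2l ?(ltW cA0)//.
  rewrite (le_trans (HY _))// ler_wpM2l ?(ltW cY0)// (le_trans _ (HB x))//.
  exact: (nm_coproj_le hdot oh).
have L0 : 0 <= L by have := sL 0%N; rewrite big_geq.
apply/tendsP => eps eps0.
(* d and eta make each Young term of the tail at most eps / 8. Then m depends on eta, r on m, and n0
   on both; the total stays below 3 eps / 4. *)
pose d := eps / 8 / (L + 1).
have L1 : 0 < L + 1 by rewrite ltr_wpDl.
have d0 : 0 < d by rewrite !divr_gt0.
have dL : d * L <= eps / 8.
  by rewrite /d mulrAC ler_pdivrMr// ler_wpM2l ?divr_ge0 ?(ltW eps0)// lerDl.
have dp : 0 < d `^ (p - 1) by exact: powR_gt0.
have cp : 0 < c `^ p by exact: powR_gt0.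
pose eta := eps / 8 * d `^ (p - 1) / c `^ p.
have eta0 : 0 < eta by rewrite !(divr_gt0, mulr_gt0).
have [m Hm] := nneg_series_tail (fun k => powR_ge0 (v k) p) vK eta0.
pose lim_r r := \sum_(0 <= j < m) (v j)%:C * dot (N r (S (g j))) (a j).
have tlim : tends lim_r 0.
  have E : \sum_(0 <= j < m) (v j)%:C * dot (A (Y (B (S (g j)) - B (S (g j))))) (a j) = 0.
    by rewrite big1// => j _; rewrite subrr (linop0 lY) (linop0 lA) dot0l mulr0.
  rewrite -E; apply: (@tends_sum _ _ _ (index_iota 0 m) xpredT) => j _.
  apply: tendsMl; apply: tends_dotl => //; apply: tends_op => //; apply: tends_op => //.
  exact: (tendsB (tends_cst _) (th _)).
have e4 : 0 < eps / 4 by rewrite divr_gt0.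
have [r Hr] := proj1 (tendsP _ _) tlim _ e4; have {}Hr := Hr _ (leqnn r).
have tE := tendsD (partial_trace_finite_rank r) (partial_trace_truncation m (bN r)).
have [n0 Hn] := proj1 (tendsP _ _) tE _ e4.
exists n0 => n /Hn; rewrite subr0 in Hr *; rewrite add0r -/(lim_r r).
set t1 := partial_trace _ n; set t2 := partial_trace _ n => t12.
pose Vt x := V x - diag_sum dot v a g m x.
pose t3 := partial_trace (fun x => Vt (N r x)) n.
have -> : partial_trace (fun x => V (A (Y (B x)))) n = t1 + t2 + t3.
  rewrite /t1 /t2 /t3 -addrA -!partial_traceD; apply: eq_bigr => k _; congr (_ * dot _ _).
  rewrite /Vt [_ + (V _ - _)]addrC subrK -(linopD lV) -(linopD lA) -(linopD lY).
  by rewrite /Q addrC subrK.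
have t3e : nm t3 <= eps / 8 + eps / 8.
  have h1 := diag_schatten_comp hdot n (ltW p1) (fun j => svd_ge0 hV (j + m)%N)
    (ons_shift m (svd_onsl hV)) (ons_shift m (svd_onsr hV)) (diag_tail m (svd_diag hV))
    Hm (aN r) c0 (Nc r) oe of_.
  rewrite (le_trans (partial_trace_young d0 h1))// lerD//.
  have -> // : (d `^ (p - 1))^-1 * (c `^ p * eta) = eps / 8.
  by rewrite /eta; field; rewrite !gt_eqF.
have := nm_tri (lim_r r) (t1 + t2) 0; rewrite !subr0 => h2.
have := nmD (t1 + t2) t3; lra.
Qed.

End GradientTrace.
End Trace.

(** * Minimality and stationarity *)

Section Minimization.
Variables (R : realType) (H : completeNormedModType R[i]).
Variable dot : {dot H for Num.conj}.
Hypothesis hdot : hilbert_dot dot.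
Hypothesis hsep : separable_space H.
Local Notation C := R[i].

Lemma schatten_sum_ge0 p (T : H -> H) : (0 <= schatten_sum dot p T)%E.
Proof.
apply: esum_ge0 => l _; rewrite mule_ge0 ?lee_fin ?powR_ge0//.
apply: ereal_sup_ubound; exists 0%N => //; exists (fun=> 0); split=> [[]//|c _ []//].
Qed.

Lemma weighted_normE p (W X : H -> H) : 0 < p ->
  (weighted_norm dot p W X `^ p)%E = schatten_sum dot p (sqrt_op dot W \o X).
Proof.
move=> p0; rewrite /weighted_norm /schatten_norm -poweRrM mulVf ?gt_eqF//.
by rewrite poweRe1// schatten_sum_ge0.
Qed.

Lemma schatten_sum_bound p (V : H -> H) V' v a g : bounded_op V -> is_adj dot V V' ->
  svd dot V v a g -> 0 < p -> (schatten_sum dot p V < +oo)%E ->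
  exists K, forall n, \sum_(0 <= k < n) v k `^ p <= K.
Proof.
move=> bV aV hV p0 Vlt; exists (fine (schatten_sum dot p V)) => n.
rewrite -lee_fin fineK ?(schatten_sum_ge hdot bV aV hV)//.
by rewrite ge0_fin_numE ?schatten_sum_ge0.
Qed.

Variables (p : R) (p1 : 1 < p).
Variables (V V' : H -> H) (v : nat -> R) (a g : nat -> H) (K : R).
Hypotheses (bV : bounded_op V) (aV : is_adj dot V V') (cV : seqcompact V).
Hypotheses (hV : svd dot V v a g) (vK : forall n, \sum_(0 <= k < n) v k `^ p <= K).

Let p0 : 0 < p. Proof. exact: lt_trans ltr01 p1. Qed.

(** Since s_k = <V M e_k, f_k>, summability passes from V to V M; the functional is thus finite
    everywhere. *)
Lemma schatten_sum_value M T' s e f : bounded_op M -> is_adj dot (V \o M) T' ->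
  svd dot (V \o M) s e f ->
  exists l, [/\ schatten_sum dot p (V \o M) = l%:E,
    (fun n => \sum_(0 <= k < n) s k `^ p) @ \oo --> l &
    forall n, \sum_(0 <= k < n) s k `^ p <= l].
Proof.
move=> bM aT hT; have [M' aM] := adj_exists hdot hsep bM.
have [c c0 Mc] := bop_bound1 bM; have bT := bop_comp bV bM.
have sL n : \sum_(0 <= k < n) s k `^ p <= c `^ p * K.
  apply: le_trans (diag_schatten_comp hdot n (ltW p1) (svd_ge0 hV) (svd_onsl hV)
    (svd_onsr hV) (svd_diag hV) vK aM c0 Mc (svd_onsl hT) (svd_onsr hT)).
  apply: ler_sum => k _; rewrite -[V (M _)]/((V \o M) (e k)) (svd_dot hT) nmR ger0_norm//.
  exact: svd_ge0 hT k.
have [l [lcvg lle]] := nneg_series_cvg (fun k => powR_ge0 (s k) p) sL.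
exists l; split=> //; apply/eqP; rewrite eq_le (schatten_sum_le hdot bT aT hT)//=.
have fin : schatten_sum dot p (V \o M) \is a fin_num.
  rewrite ge0_fin_numE ?schatten_sum_ge0//.
  by rewrite (le_lt_trans (schatten_sum_le hdot bT aT hT p0 lle))// ltry.
rewrite -(fineK fin) lee_fin; apply: (cvgr_to_le lcvg); apply: nearW => n.
by rewrite -lee_fin (fineK fin) (schatten_sum_ge hdot bT aT hT).
Qed.

Lemma svd_comp M : bounded_op M -> exists T' s e f,
  is_adj dot (V \o M) T' /\ svd dot (V \o M) s e f.
Proof.
move=> bM; have [M' aM] := adj_exists hdot hsep bM.
have aT := is_adj_comp aV aM; have [lV _] := bV.
have [s [e [f hT]]] := svd_exists hdot (bop_comp bV bM) aT (seqcompact_comp lV cV bM).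
by exists (M' \o V'), s, e, f.
Qed.

Variables (A B Cop X0 : H -> H).
Hypotheses (bA : bounded_op A) (bB : bounded_op B) (bC : bounded_op Cop) (bX0 : bounded_op X0).

Let M X : H -> H := (A \o X \o B) \- Cop.

Lemma bop_M X : bounded_op X -> bounded_op (M X).
Proof. by move=> bX; apply: bop_sub => //; exact: (bop_comp (bop_comp bA bX) bB). Qed.

Variables (T' S : H -> H) (s : nat -> R) (e f : nat -> H).
Let T := V \o M X0.
Hypotheses (bT : bounded_op T) (aT : is_adj dot T T') (hT : svd dot T s e f).
Hypothesis hS : diag dot S (fun k => s k `^ (p - 1)) f e.

Let adjoint_gradient : exists G, bounded_op G /\ diag dot G (fun k => s k `^ (p - 1)) e f.
Proof.
have [L L0 sL] := svd_Tbound hdot bT hT.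
have [|G [hG bG]] := @diag_bound_exists _ _ _ hdot (fun k => s k `^ (p - 1)) e f
    (svd_onsl hT) (svd_onsr hT).
  exists (L `^ (p - 1)); first exact: powR_ge0.
  move=> k; rewrite ger0_norm ?powR_ge0// ge0_ler_powR ?nnegrE ?(svd_ge0 hT)//.
  by rewrite subr_ge0 ltW.
by exists G.
Qed.

Lemma diff_M X x : bounded_op X ->
  (V \o M X) x - T x = V (A (X (B x) - X0 (B x))).
Proof.
move=> bX; have [[lV _] [lA _]] := conj bV bA.
by rewrite /T /= -(linopB lV) /M /= opprB addrA subrK (linopB lA).
Qed.

Lemma stationary_minimal : (forall x, B (S (V (A x))) = 0) ->
  global_min (fun X => schatten_sum dot p (V \o M X)) X0.
Proof.
move=> BSVA X bX; have [T1' [s1 [e1 [f1 [aT1 hT1]]]]] := svd_comp (bop_M bX).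
have [G [bG hG]] := adjoint_gradient.
have [A' aA] := adj_exists hdot hsep bA; have [B' aB] := adj_exists hdot hsep bB.
have bY := bop_sub bX bX0; have [Y' aY] := adj_exists hdot hsep bY.
have [h hh] := total_ons_exists hdot hsep.
have [l1 [-> _ l1le]] := schatten_sum_value (bop_M bX) aT1 hT1.
have [l [-> lcvg lle]] := schatten_sum_value (bop_M bX0) aT hT.
have tr0 := partial_trace_cvg0 hdot p1 hT lle hS hG bV hV vK bA bB bY aA aB aY hh BSVA.
(* The lower bounds given by the subgradient inequality converge to the value at X0, as the trace
   term tends to 0. *)
have c1 : (fun n => \sum_(0 <= k < n) s k `^ p +
    p * complex.Re (partial_trace dot p s e f (fun x => V (A (X (B x) - X0 (B x)))) n))
    @ \oo --> l.
  have -> : l = l + p * complex.Re (0 : C) by rewrite mulr0 addr0.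
  by apply: cvgD => //; apply: cvgMr; exact: tends_Re tr0.
rewrite lee_fin; apply: (cvgr_to_le c1); apply: nearW => n.
rewrite (_ : partial_trace _ _ _ _ _ _ n = partial_trace dot p s e f (fun x => (V \o M X) x - T x) n).
  exact: (subgradient hdot (ltW p1) hT n hT1 l1le).
by apply: eq_bigr => k _; rewrite diff_M.
Qed.

Section RankOnePerturbation.
Variables (G : H -> H) (w u : H) (z : C) (B' : H -> H).
Hypotheses (aB : is_adj dot B B') (hG : diag dot G (fun k => s k `^ (p - 1)) e f).
Hypothesis minX0 : global_min (fun X => schatten_sum dot p (V \o M X)) X0.

Let t n : R := n.+1%:R^-1.
Let X n x := X0 x + ((t n)%:C * z) *: (dot x u *: w).
Let D x := dot x (B' u) *: (z *: V (A w)).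

Let bX n : bounded_op (X n).
Proof. by apply: bop_add => //; apply: bop_scale; exact: bop_rank1. Qed.

Let V_M_X n x : (V \o M (X n)) x = T x + (t n)%:C *: D x.
Proof.
have [[lV _] [lA _]] := conj bV bA.
rewrite -[LHS](subrK (T x)) diff_M// [RHS]addrC; congr (_ + _).
rewrite /X addrAC subrr add0r aB.2 /D (linopZ lA) (linopZ lA) (linopZ lV) (linopZ lV) !scalerA.
by congr (_ *: _); ring.
Qed.

Let t0 n : 0 < t n. Proof. by rewrite invr_gt0. Qed.

(* The subgradient inequality is used at the perturbed operators V (M (X n)), so
   that no differentiability of the p-norm at T is required. *)
Lemma minimal_derivative_ge0 : 0 <= complex.Re (z * dot (V (A w)) (G (B' u))).
Proof.
have bD : bounded_op D by exact: bop_rank1.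
have [cD cD0 Dc] := bop_bound bD; have [cT cT0 Tc] := bop_bound bT.
have [Tn' hTn'] : {Tn' : nat -> H -> H & forall n, exists s e f,
    is_adj dot (V \o M (X n)) (Tn' n) /\ svd dot (V \o M (X n)) s e f}.
  apply: (@choice _ _ (fun n T' => exists s e f,
    is_adj dot (V \o M (X n)) T' /\ svd dot (V \o M (X n)) s e f)) => n.
  exact: svd_comp (bop_M (bX n)).
have [sn hsn] := choice hTn'; have [en hen] := choice hsn; have [fn hfn] := choice hen.
have bTn n : bounded_op (V \o M (X n)) by apply: bop_comp => //; exact: bop_M.
have [Gn hGn] : {Gn : nat -> H -> H & forall n,
    diag dot (Gn n) (fun k => sn n k `^ (p - 1)) (en n) (fn n)}.
  apply: (@choice _ _ (fun n G => diag dot G (fun k => sn n k `^ (p - 1)) (en n) (fn n))) => n.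
  have [_ hTn] := hfn n; have [L L0 sL] := svd_Tbound hdot (bTn n) hTn.
  have [|G1 [hG1 _]] := @diag_bound_exists _ _ _ hdot (fun k => sn n k `^ (p - 1)) _ _
      (svd_onsl hTn) (svd_onsr hTn); last by exists G1.
  exists (L `^ (p - 1)); first exact: powR_ge0.
  move=> k; rewrite ger0_norm ?powR_ge0// ge0_ler_powR ?nnegrE ?(svd_ge0 hTn)//.
  by rewrite subr_ge0 ltW.
(* With ln and l the values at X n and X0, the inequality from X n to X0 reads ln - p t_n Re(...) <=
   l, and minimality gives l <= ln. *)
have step n : 0 <= complex.Re (z * dot (V (A w)) (Gn n (B' u))).
  have [aTn hTn] := hfn n.
  have [ln [lnE lncvg lnle]] := schatten_sum_value (bop_M (bX n)) aTn hTn.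
  have [l [lE _ lle]] := schatten_sum_value (bop_M bX0) aT hT.
  have lln : l <= ln by have := minX0 (bX n); rewrite lnE lE lee_fin.
  have tr := partial_trace_rank1 hdot (B' u) (z *: V (A w)) (hGn n).
  rewrite dotZl in tr.
  have c1 : (fun m => \sum_(0 <= k < m) sn n k `^ p -
      p * (t n * complex.Re (partial_trace dot p (sn n) (en n) (fn n) D m)))
      @ \oo --> ln - p * (t n * complex.Re (z * dot (V (A w)) (Gn n (B' u)))).
    by apply: cvgB => //; apply: cvgMr; apply: cvgMr; exact: tends_Re tr.
  have : ln - p * (t n * complex.Re (z * dot (V (A w)) (Gn n (B' u)))) <= l.
    apply: (cvgr_to_le c1); apply: nearW => m.
    apply: le_trans (subgradient hdot (ltW p1) hTn m hT lle).
    rewrite lerD2l -mulrN -cReMl -cReN mulr_sumr -sumrN le_eqVlt; apply/orP; left.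
    apply/eqP; congr (_ * complex.Re _); apply: eq_bigr => k _.
    rewrite V_M_X opprD addrA subrr add0r dotNl dotZl; ring.
  move=> h; have : 0 <= p * (t n * complex.Re (z * dot (V (A w)) (Gn n (B' u)))) by lra.
  by rewrite pmulr_rge0// pmulr_rge0.
have cont : tends (fun n => Gn n (B' u)) (G (B' u)).
  apply: (gradient_cvg hdot p1 bT aT hT hG bTn (fun n => (hfn n).1) (fun n => (hfn n).2) hGn
    (d := fun n => t n * cD) (M := cT + cD)).
  - by move=> n; rewrite mulr_ge0// ltW.
  - by rewrite -[X in _ --> X](mul0r cD); apply: cvgMl; exact: cvg_harmonic.
  - exact: addr_ge0.
  - move=> n x; rewrite V_M_X addrC addKr nmZ nmR ger0_norm ?(ltW (t0 n))//.
    by rewrite -mulrA ler_wpM2l ?(ltW (t0 n)).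
  - move=> n x; rewrite V_M_X (le_trans (nmD _ _))// mulrDl lerD//.
    rewrite nmZ nmR ger0_norm ?(ltW (t0 n))// (le_trans _ (Dc x))//.
    by rewrite ler_piMl ?nm_ge0// invf_le1// ler1n.
have := tends_Re (tendsMl z (tends_dotr hdot (V (A w)) cont)).
by move=> c1; apply: (cvgr_to_ge c1); exact: nearW.
Qed.

End RankOnePerturbation.

(** For u = B S V A x, the derivative along the rank one direction - <., u> x is a positive multiple
    of - |u|^2, and minimality makes it nonnegative. *)
Lemma minimal_stationary : global_min (fun X => schatten_sum dot p (V \o M X)) X0 ->
  forall x, B (S (V (A x))) = 0.
Proof.
move=> minX0 x; have [G [bG hG]] := adjoint_gradient.
have [B' aB] := adj_exists hdot hsep bB.
apply: (dotxx_eq0 hdot); set u := B _.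
have E : dot (V (A x)) (G (B' u)) = dot u u by rewrite -(diag_adj hdot hS hG) -aB.2.
have := minimal_derivative_ge0 x u (-1) aB hG minX0.
rewrite E (dotxx hdot) mulN1r cReN oppr_ge0 /= => u0.
by rewrite (_ : nm u ^+ 2 = 0)//; apply/eqP; rewrite eq_le u0 sqr_ge0.
Qed.

End Minimization.


Theorem lemma4p2 (R : realType) (H : completeNormedModType R[i])
    (dot : {dot H for Num.conj}) (hdot : hilbert_dot dot)
    (hsep : separable_space H)
    (A B C W : H -> H) (p : R)
    (hA : bounded_op A) (hAcl : closed (range A))
    (hB : bounded_op B) (hBcl : closed (range B))
    (hC : bounded_op C) (hW : positive_op dot W)
    (hp : 1 < p) (hWp : schatten_class dot p (sqrt_op dot W))
    (X0 : H -> H) (hX0 : bounded_op X0) :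
  global_min
    (fun X => (weighted_norm dot p W ((A \o X \o B) \- C)%R `^ p)%E) X0
  <->
  let T := sqrt_op dot W \o ((A \o X0 \o B) \- C) in
  B \o pow_op (abs_op dot T) (p - 1) \o adjoint dot (polar_op dot T)
    \o sqrt_op dot W \o A = (fun=> 0).
Proof.
have p0 : 0 < p := lt_trans ltr01 hp.
have -> : (fun X => (weighted_norm dot p W ((A \o X \o B) \- C)%R `^ p)%E) =
    (fun X => schatten_sum dot p (sqrt_op dot W \o ((A \o X \o B) \- C))).
  by apply/funext => X; exact: weighted_normE.
move: hWp; set V := sqrt_op dot W => -[cpV Vfin].
have bV : bounded_op V by case: cpV.
have [V' aV] := adj_exists hdot hsep bV.
have cV := compact_op_seqcompact cpV.
have [v [a [g hV]]] := svd_exists hdot bV aV cV.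
have [K vK] := schatten_sum_bound hdot bV aV hV p0 Vfin.
have bM := bop_M hA hB hC hX0; have bT := bop_comp bV bM.
have [T' [s [e [f [aT hT]]]]] := svd_comp hdot hsep bV aV cV bM.
have [S [bS hS SE]] := gradientE hdot bT aT hT hp.
have eqS x : (B \o pow_op (abs_op dot (V \o ((A \o X0 \o B) \- C))) (p - 1) \o
    adjoint dot (polar_op dot (V \o ((A \o X0 \o B) \- C))) \o V \o A) x = B (S (V (A x))).
  by rewrite -SE.
split=> [minX0 T|BSVA].
  apply/funext => x; rewrite eqS.
  exact: (minimal_stationary hdot hsep hp bV aV cV hV vK hA hB hC hX0 bT aT hT hS minX0).
apply: (stationary_minimal hdot hsep hp bV aV cV hV vK hA hB hC hX0 bT aT hT hS) => x.
by rewrite -eqS BSVA.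
Qed.
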